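(* Let $|A|=n\ge 2$. Fix $k\ge 1$ and let $S$ be the interval of consecutive ranks $[r,k]$ for $1\le r\le k$. Then the rank-selected subposet $A^*_{n,k}(S)$ has unique nonvanishing homology in degree $k-r$, and the $S_n$-homology representation on $\tilde H_{k-r}(A^*_{n,k}(S))$ is given by the decomposition $$\bigoplus_{i=1+k-r}^{k} b_i\, S_{(n-1,1)}^{\otimes i},\qquad b_i=\binom{k}{i}\binom{i-1}{k-r},\quad i=1+k-r,\dots,k.$$
   Context: $A^*$ is the set of all finite words in the alphabet $A$, $|A|=n$, including the empty word, ordered by the subword order: $u\le v$ if $u$ is obtained from $v$ by deleting letters (not necessarily consecutive). The rank of a word is its length. For $S\subseteq[1,k]=\{1,\dots,k\}$, $A^*_{n,k}(S)$ is the subposet of words with length in $S$; its homology means the reduced simplicial homology, with complex coefficients, of its order complex (any attached bottom or top element is removed before taking the order complex). $S_n$ acts by permuting the letters of $A$. $S_{(n-1,1)}$ is the irreducible complex $S_n$-module indexed by the partition $(n-1,1)$, and $b\,V$ denotes a direct sum of $b$ copies of $V$. *)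

(* Defs.v *)
From HB Require Import structures.
From mathcomp Require Import all_boot all_order all_algebra all_fingroup.
From mathcomp Require Import all_character.
From mathcomp Require Import reals complex.

Set Implicit Arguments.
Unset Strict Implicit.
Unset Printing Implicit Defensive.

Import Order.TTheory GRing.Theory Num.Theory.
Local Open Scope ring_scope.

(* As everywhere in [mxrepresentation], matrices act on row vectors from the  *)
(* right, and [(s * t) x = t (s x)] in {perm T}.  A right module in these     *)
(* conventions is the same thing as a left module over the symmetric group    *)
(* whose product is composition of functions, [(s \o t) x = s (t x)].         *)

Section PermutationModule.
Variables (F : fieldType) (gT : finGroupType) (X : finType).
Variable to : {action gT &-> X}.

Definition act_mx (g : gT) : 'M[F]_#|X| :=
  \matrix_i delta_mx 0 (enum_rank (to (enum_val i) g)).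

Lemma delta_act_mx (x : X) (g : gT) :
  delta_mx 0 (enum_rank x) *m act_mx g
    = delta_mx 0 (enum_rank (to x g)) :> 'rV_#|X|.
Proof. by rewrite -rowE rowK enum_rankK. Qed.

Lemma act_mx_repr : mx_repr [set: gT] act_mx.
Proof.
split=> [|g h _ _]; apply/row_matrixP=> i.
  by rewrite rowK act1 enum_valK row1.
by rewrite row_mul !rowK delta_act_mx actM.
Qed.

Definition act_repr : mx_representation F [set: gT] #|X| :=
  MxRepresentation act_mx_repr.

End PermutationModule.

Section OrderComplex.
Variables (d : Order.disp_t) (T : finPOrderType d).

(* A chain on p vertices, i.e. a simplex of dimension p - 1 of the order      *)
(* complex; the only chain on 0 vertices is the empty simplex.                *)
Definition chain (p : nat) : predArgType :=
  {c : p.-tuple T | sorted <%O c}.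

HB.instance Definition _ p := [Countable of chain p by <:].
HB.instance Definition _ p := [Finite of chain p by <:].

Lemma face_subseq p (c : p.+1.-tuple T) (a : 'I_p.+1) :
  subseq (take a c ++ drop a.+1 c) c.
Proof.
rewrite -[X in subseq _ X](cat_take_drop a) cat_subseq //.
by rewrite -addn1 addnC -drop_drop drop_subseq.
Qed.

Lemma face_size p (c : p.+1.-tuple T) (a : 'I_p.+1) :
  size (take a c ++ drop a.+1 c) == p.
Proof.
rewrite size_cat size_drop size_takel size_tuple; last exact: ltnW.
by rewrite subSS subnKC // -ltnS.
Qed.

Lemma face_sorted p (c : chain p.+1) (a : 'I_p.+1) :
  sorted <%O (Tuple (face_size (val c) a)).
Proof. exact: (subseq_sorted lt_trans (face_subseq _ _) (valP c)). Qed.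

Definition face p (c : chain p.+1) (a : 'I_p.+1) : chain p :=
  exist _ (Tuple (face_size (val c) a)) (face_sorted c a).

Variable F : fieldType.

(* The partial order orients every simplex, so F^(chain p) is the space of    *)
(* oriented (p - 1)-chains of the order complex, augmented by F in degree -1. *)
Definition boundary_mx p : 'M[F]_(#|chain p.+1|, #|chain p|) :=
  \matrix_i \sum_(a < p.+1)
    (-1) ^+ a *: delta_mx 0 (enum_rank (face (enum_val i) a)).

Definition cycles p : 'M[F]_#|chain p| :=
  if p is p'.+1 return 'M[F]_#|chain p|
  then kermx (boundary_mx p') else 1%:M.

Definition boundaries p : 'M[F]_#|chain p| := <<boundary_mx p>>%MS.

End OrderComplex.

Section HomologyRepresentation.
Variables (d : Order.disp_t) (T : finPOrderType d) (F : fieldType).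
Variables (gT : finGroupType) (to : {action gT &-> T}).
Hypothesis to_mono : forall g, {homo to^~ g : x y / (x < y)%O}.

Lemma chain_act_sorted p (c : chain T p) g :
  sorted <%O (map_tuple (to^~ g) (val c)).
Proof. by apply: (homo_sorted (@to_mono g)) (valP c). Qed.

Definition chain_act p (c : chain T p) (g : gT) : chain T p :=
  exist _ (map_tuple (to^~ g) (val c)) (chain_act_sorted c g).

Lemma chain_act1 p : (@chain_act p)^~ 1%g =1 id.
Proof.
move=> c; do 2!apply: val_inj => /=.
by rewrite (eq_map (act1 to)) map_id.
Qed.

Lemma chain_actM p (c : chain T p) : act_morph (@chain_act p) c.
Proof.
move=> g h; do 2!apply: val_inj => /=.
by rewrite -map_comp; apply: eq_map => x /=; rewrite actM.
Qed.

Definition chain_action p : {action gT &-> chain T p} :=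
  TotalAction (@chain_act1 p) (@chain_actM p).

Definition chain_repr p := act_repr F (chain_action p).

Lemma face_act p (c : chain T p.+1) (a : 'I_p.+1) g :
  face (chain_act c g) a = chain_act (face c a) g.
Proof. by do 2!apply: val_inj => /=; rewrite map_cat map_take map_drop. Qed.

Lemma boundary_mxJ p g :
  chain_repr p.+1 g *m boundary_mx T F p = boundary_mx T F p *m chain_repr p g.
Proof.
apply/row_matrixP=> i; rewrite !row_mul !rowK -rowE rowK enum_rankK.
rewrite mulmx_suml; apply: eq_bigr => a _.
by rewrite -scalemxAl delta_act_mx /= face_act.
Qed.

Lemma cycles_module p : mxmodule (chain_repr p) (cycles T F p).
Proof.
case: p => [|p]; first exact: mxmodule1.
apply/mxmoduleP=> g _; apply/sub_kermxP.
by rewrite -mulmxA boundary_mxJ mulmxA mulmx_ker mul0mx.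
Qed.

Lemma boundaries_module p : mxmodule (chain_repr p) (boundaries T F p).
Proof.
rewrite (eqmx_module _ (genmxE _)); apply/mxmoduleP=> g _.
by rewrite -boundary_mxJ submxMl.
Qed.

(* [section_repr] of U and V is V / (U :&: V).  The degree is that of the     *)
(* simplices, so degree m involves chains on m.+1 vertices.                   *)
Definition homology_at p : representation F [set: gT] :=
  Representation (section_repr (boundaries_module p) (cycles_module p)).

Definition homology_repr (m : int) : representation F [set: gT] :=
  match m with
  | Posz m' => homology_at m'.+1
  | Negz 0 => homology_at 0
  | Negz _.+1 => grepr0
  end.

End HomologyRepresentation.

Section RankSelectedWords.
Variables (A : finType) (k : nat) (S : pred nat).

Definition word_poset : predArgType := {w : k.-bseq A | S (size w)}.

HB.instance Definition _ := [Countable of word_poset by <:].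
HB.instance Definition _ := [Finite of word_poset by <:].

Definition subword : rel word_poset := fun u v => subseq (val u) (val v).

Lemma subword_refl : reflexive subword.
Proof. by move=> u; apply: subseq_refl. Qed.

Lemma subword_anti : antisymmetric subword.
Proof. by move=> u v /subseq_anti uv; do 2!apply: val_inj. Qed.

Lemma subword_trans : transitive subword.
Proof. by move=> u v w; apply: subseq_trans. Qed.

Fact subword_display : Order.disp_t. Proof. exact: Order.Disp tt tt. Qed.

HB.instance Definition _ := Order.Le_isPOrder.Build subword_display word_poset
  subword_refl subword_anti subword_trans.

Lemma word_act_size (w : word_poset) (s : {perm A}) :
  (size (map s (val w)) <= k)%N.
Proof. by rewrite size_map size_bseq. Qed.

Lemma word_act_rank (w : word_poset) (s : {perm A}) :
  S (size (Bseq (word_act_size w s))).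
Proof. by rewrite /= size_map (valP w). Qed.

Definition word_act (w : word_poset) (s : {perm A}) : word_poset :=
  exist _ (Bseq (word_act_size w s)) (word_act_rank w s).

Lemma word_act1 : word_act^~ 1%g =1 id.
Proof.
move=> w; do 2!apply: val_inj => /=.
by rewrite (eq_map (@perm1 A)) map_id.
Qed.

Lemma word_actM w : act_morph word_act w.
Proof.
move=> s t; do 2!apply: val_inj => /=.
by rewrite -map_comp; apply: eq_map => x /=; rewrite permM.
Qed.

Definition word_action : {action {perm A} &-> word_poset} :=
  TotalAction word_act1 word_actM.

Lemma word_act_mono (s : {perm A}) :
  {homo word_action^~ s : u v / (u < v)%O}.
Proof.
move=> u v; rewrite !lt_def => /andP[neq_vu le_uv]; apply/andP; split.
  by rewrite (inj_eq (act_inj word_action s)).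
exact: map_subseq.
Qed.

End RankSelectedWords.

Definition word_homology (F : fieldType) (A : finType) (k : nat)
    (S : pred nat) (m : int) : representation F [set: {perm A}] :=
  homology_repr F (@word_act_mono A k S) m.

Section Specht.
Variables (F : fieldType) (n : nat) (la : seq nat).

(* For a partition la of n, the canonical tableau of shape la lists           *)
(* 0, ..., n - 1 row after row; these are the row and the column of i in it.  *)
Definition tab_row (i : 'I_n) := reshape_index la i.
Definition tab_col (i : 'I_n) := reshape_offset la i.

Definition row_stab : {set 'S_n} :=
  [set p : 'S_n | [forall i, tab_row (p i) == tab_row i]].
Definition col_stab : {set 'S_n} :=
  [set q : 'S_n | [forall i, tab_col (q i) == tab_col i]].

(* The Young symmetrizer a * b of the canonical tableau for the composition   *)
(* product: the sum of sgn(q) (p \o q) for p in the row group and q in the    *)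
(* column group, where p \o q is [q * p] here.                                *)
Definition young_symmetrizer : 'rV[F]_#|[set: 'S_n]| :=
  \sum_(p in row_stab) \sum_(q in col_stab)
    (-1) ^+ q *: delta_mx 0 (gring_index [set: 'S_n] (q * p)%g).

(* The one-sided ideal of the group algebra generated by the symmetrizer.     *)
Definition specht_repr : representation F [set: 'S_n] :=
  Representation
    (submod_repr (cyclic_mx_module (regular_repr F [set: 'S_n])
                                   young_symmetrizer)).

End Specht.

Section TensorPower.
Variables (F : fieldType) (gT : finGroupType) (G : {group gT}).

Lemma triv_mx_repr : mx_repr G (fun _ : gT => 1%:M : 'M[F]_1).
Proof. by split=> // g h _ _; rewrite mulmx1. Qed.

Definition triv_repr : representation F G :=
  Representation (MxRepresentation triv_mx_repr).

Fixpoint tensor_power (V : representation F G) (i : nat) :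
    representation F G :=
  if i is i'.+1 then Representation (prod_repr V (tensor_power V i'))
  else triv_repr.

End TensorPower.

(* Main.v *)
(** A chain fixed by a permutation g consists of words over the letters fixed
    by g, so the character of each chain module at g is a number of chains in
    the same poset over a smaller alphabet.  Words containing a given word of
    length j are counted by a recursion in j and their length only; this
    evaluates the alternating sum of these characters, which is
    sum_i b_i (f - 1)^i for f fixed letters, and f - 1 is the character of
    S_(n-1,1).

    By the Hopf trace formula this sum is the character of the top homology,
    once the lower homology vanishes.  For this, words of length at most k are
    the subwords of a long enough word a w.  Putting a in front of the words
    that do not start with it is a closure operator, so the subwords of a w
    with length in [r, s] that have length < s or start with a retract onto
    those starting with a, which form the poset of subwords of w with length
    in [r - 1, s - 1].  The remaining subwords have length s and are maximal;
    adding them attaches cones over posets of proper subwords of words shorter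
    than a w.  Both pieces are spherical by induction.

    In characteristic zero equal characters give isomorphic representations:
    the average of the maps X |-> rho1(g^-1) X rho2(g) is idempotent, so its
    rank is its trace, the mean of chi1(g^-1) chi2(g), and depends only on the
    characters.  Hence two modules with the same nonzero character have a
    nonzero homomorphism between them, which Maschke's theorem splits off. *)

From HB Require Import structures.
Require Import Defs.
From mathcomp Require Import all_boot all_order all_algebra all_fingroup.
From mathcomp Require Import all_solvable all_character.
From mathcomp Require Import reals complex.
From mathcomp Require Import ring zify.

Set Implicit Arguments.
Unset Strict Implicit.
Unset Printing Implicit Defensive.

Import Order.TTheory GRing.Theory Num.Theory.
Local Open Scope ring_scope.

(** * Cochains of order complexes *)

Section Cochains.
Variables (d : Order.disp_t) (T : porderType d) (F : comPzRingType).
Implicit Types (f g : seq T -> F) (X Y : pred T) (c : seq T) (p : nat).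

(* Cochains are functions on all sequences, of which only the values on
   strictly increasing sequences matter.  See [cobdE] for the closed form. *)
Fixpoint cobd f c : F :=
  if c is x :: c' then f c' - cobd (f \o cons x) c' else 0.

Lemma eq_cobd f g c :
    (forall e, subseq e c -> (size e).+1 = size c -> f e = g e) ->
  cobd f c = cobd g c.
Proof.
elim: c f g => [//|x c IH] f g fg /=; congr (_ - _).
  by apply: fg; rewrite ?subseq_cons.
by apply: IH => e sec se /=; apply: fg; rewrite /= ?eqxx ?se.
Qed.

Lemma cobdN f c : cobd (fun e => - f e) c = - cobd f c.
Proof.
elim: c f => [|x c IH] f /=; first by rewrite oppr0.
by rewrite [cobd (_ \o _) c in LHS]IH /= opprD.
Qed.

Lemma cobdB f g c : cobd (fun e => f e - g e) c = cobd f c - cobd g c.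
Proof.
elim: c f g => [|x c IH] f g /=; first by rewrite subr0.
rewrite [cobd (_ \o _) c in LHS](IH (f \o cons x) (g \o cons x)).
ring.
Qed.

Lemma cobd0 c : cobd (fun=> 0) c = 0.
Proof. by elim: c => //= x c ->; rewrite subr0. Qed.

Lemma cobdK f c : cobd (cobd f) c = 0.
Proof.
elim: c f => //= x c IH f.
have -> : cobd (cobd f \o cons x) c
       = cobd (fun e => f e - cobd (f \o cons x) e) c by [].
by rewrite cobdB IH subr0 subrr.
Qed.

Lemma cobdE f c :
  cobd f c = \sum_(a < size c) (-1) ^+ a * f (take a c ++ drop a.+1 c).
Proof.
elim: c f => [|x c IH] f /=; first by rewrite big_ord0.
rewrite big_ord_recl /= mul1r drop0 IH -sumrN; congr (_ + _).
by apply: eq_bigr => a _ /=; rewrite exprS mulN1r mulNr.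
Qed.

Definition chain_in X p c := [&& size c == p, sorted <%O c & all X c].

Lemma chain_in_sub X p c e :
  chain_in X p.+1 c -> subseq e c -> (size e).+1 = size c -> chain_in X p e.
Proof.
case/and3P=> /eqP sc oc Xc ec; rewrite sc => -[se].
apply/and3P; split; [by rewrite se | exact: (subseq_sorted lt_trans ec oc) |].
by apply/allP=> y /(mem_subseq ec) /(allP Xc).
Qed.

Lemma chain_inS X Y p c : subpred X Y -> chain_in X p c -> chain_in Y p c.
Proof.
move=> XY /and3P[sc oc Xc]; apply/and3P; split=> //.
by apply: sub_all Xc.
Qed.

(* Since p counts vertices, this is the vanishing of the reduced cohomology of
   X in degree p - 1; for p = 0 it says that X is nonempty. *)
Definition acyclic X p := forall f,
  (forall c, chain_in X p.+1 c -> cobd f c = 0) ->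
  exists g, forall c, chain_in X p c -> f c = cobd g c.

Lemma eq_acyclic X Y p : X =1 Y -> acyclic X p -> acyclic Y p.
Proof.
move=> XY aX f fY.
have E q c : chain_in X q c = chain_in Y q c by rewrite /chain_in (eq_all XY).
have [c|g gP] := aX f; first by rewrite E; apply: fY.
by exists g => c; rewrite -E; apply: gP.
Qed.

Definition link x X : pred T := fun y => X y && ((y < x)%O || (x < y)%O).
Definition ins x c :=
  [seq y <- c | (y < x)%O] ++ x :: [seq y <- c | ~~ (y < x)%O].
(* The sign of the position of [x] in [ins x c]. *)
Definition isgn x c : F := (-1) ^+ count (fun y => (y < x)%O) c.

Lemma isgnK x c a : isgn x c * (isgn x c * a) = a.
Proof. by rewrite mulrA -expr2 sqrr_sign mul1r. Qed.

Lemma ins_above x c : all (fun y => ~~ (y < x)%O) c -> ins x c = x :: c.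
Proof.
move=> xc; rewrite /ins (all_filterP xc).
rewrite (eq_in_filter (a2 := pred0)) ?filter_pred0 // => y yc.
exact/negbTE/(allP xc).
Qed.

Lemma isgn_above x c : all (fun y => ~~ (y < x)%O) c -> isgn x c = 1.
Proof.
move=> xc; rewrite /isgn (eq_in_count (a2 := pred0)) ?count_pred0 // => y yc.
exact/negbTE/(allP xc).
Qed.

(** Deleting [x] gives the term [f c]. Deleting another vertex commutes with inserting [x], up to a
    sign that depends on whether it lies below [x]; [isgn] absorbs it. *)
Lemma cobd_ins f x c X p : chain_in (link x X) p c ->
  cobd f (ins x c)
    = isgn x c * (f c - cobd (fun e => isgn x e * f (ins x e)) c).
Proof.
elim: c f p => [|y c IH] f p.
  by move=> _; rewrite /= /isgn /= mul1r.
case/and3P=> sp oy; rewrite [all _ _]/= => /andP[/andP[_ cyx] Lc].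
have oc := path_sorted oy.
have cc : chain_in (link x X) (size c) c by rewrite /chain_in eqxx oc.
have [yx|nyx] := boolP (y < x)%O.
  have iE e : ins x (y :: e) = y :: ins x e by rewrite /ins /= yx.
  have gE e : isgn x (y :: e) = - isgn x e.
    by rewrite /isgn /= yx add1n exprS mulN1r.
  rewrite iE gE /= (IH _ _ cc) /=.
  pose Jy e := - (isgn x e * f (y :: ins x e)).
  rewrite [cobd (_ \o _) c in RHS](eq_cobd (g := Jy)); last first.
    by move=> e _ _; rewrite /Jy /= iE gE mulNr.
  have E := isgnK x c (f (ins x c)); rewrite cobdN -{1}E; ring.
have xy : (x < y)%O by move: cyx; rewrite (negbTE nyx).
(* Once one vertex is above [x], all later ones are, and inserting [x] puts it in front. *)
have ab : all (fun z => ~~ (z < x)%O) (y :: c).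
  rewrite /= nyx /=; apply/allP=> z zc.
  have yz : (y < z)%O by apply: (allP (order_path_min lt_trans oy)).
  by rewrite lt_gtF // (lt_trans xy).
rewrite (ins_above ab) (isgn_above ab) mul1r.
transitivity (f (y :: c) - cobd (f \o cons x) (y :: c)); first by [].
congr (_ - _); apply: eq_cobd => e ec _.
have abe : all (fun z => ~~ (z < x)%O) e.
  by apply/allP=> z /(mem_subseq ec) /(allP ab).
by rewrite ins_above ?isgn_above // mul1r.
Qed.

Lemma chain_ins X x p c :
  X x -> chain_in (link x X) p c -> chain_in X p.+1 (ins x c).
Proof.
move=> Xx /and3P[/eqP sc oc Lc]; apply/and3P; split.
- by rewrite size_cat /= !size_filter addnS count_predC sc.
- move: oc; rewrite !(sorted_pairwise lt_trans) pairwise_cat /= => oc.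
  apply/and4P; split; try exact: pairwise_filter.
    apply/allrelP=> y z; rewrite mem_filter => /andP[yx yc].
    rewrite inE => /predU1P[-> //|]; rewrite mem_filter.
    case/andP=> nzx /(allP Lc) /andP[_]; rewrite (negbTE nzx) /=.
    exact: lt_trans.
  apply/allP=> y; rewrite mem_filter => /andP[nyx /(allP Lc)] /andP[_].
  by rewrite (negbTE nyx).
have Xc : all X c by apply: sub_all Lc => y /andP[].
rewrite all_cat /= Xx !all_filter.
by apply/andP; split; apply: sub_all Xc => y /= ->; rewrite implybT.
Qed.

Lemma chain_del X x p c : chain_in X p c -> x \in c ->
  exists q e, [/\ p = q.+1, chain_in (link x X) q e & c = ins x e].
Proof.
case/and3P=> /eqP sc oc Xc xc; case/splitPr: xc sc oc Xc => c1 c2 sc.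
rewrite (sorted_pairwise lt_trans) pairwise_cat /= allrel_consr.
case/and4P=> /andP[c1x c12] o1 xc2 o2.
rewrite all_cat /= => /and3P[X1 Xx X2].
have nc2 : all (fun y => ~~ (y < x)%O) c2.
  by apply: sub_all xc2 => y xy; rewrite lt_gtF.
exists (size (c1 ++ c2)), (c1 ++ c2); split.
- by rewrite -sc !size_cat /= addnS.
- rewrite /chain_in eqxx (sorted_pairwise lt_trans) pairwise_cat c12 o1 o2 /=.
  rewrite all_cat; apply/andP; split; apply/allP=> y yc; rewrite /link.
    by rewrite (allP c1x) // (allP X1).
  by rewrite (allP xc2) // orbT (allP X2).
rewrite /ins !filter_cat (all_filterP c1x) (all_filterP nc2).
have -> : [seq y <- c2 | (y < x)%O] = [::].
  rewrite (eq_in_filter (a2 := pred0)) ?filter_pred0 // => y yc.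
  exact/negbTE/(allP nc2).
have -> : [seq y <- c1 | ~~ (y < x)%O] = [::].
  by rewrite (eq_in_filter (a2 := pred0)) ?filter_pred0 // => y /(allP c1x) ->.
by rewrite cats0.
Qed.

Lemma ins_mem x c : x \in ins x c.
Proof. by rewrite mem_cat mem_head orbT. Qed.

Lemma link_notin X x p c : chain_in (link x X) p c -> x \notin c.
Proof.
case/and3P=> _ _ Lc; apply: contraT; rewrite negbK => /(allP Lc).
by rewrite /link ltxx andbF.
Qed.

(** Contracting homotopy: up to sign, [g] evaluates [f] after joining the apex [x], and is 0 on
    chains through [x]. *)
Lemma acyclic_cone X x p :
  X x -> (forall y, X y -> [|| y == x, (y < x)%O | (x < y)%O]) -> acyclic X p.
Proof.
move=> Xx cx f fX.
pose J e := isgn x e * f (ins x e).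
pose g e := if x \in e then 0 else J e; exists g => c Xc.
have JL q e : chain_in (link x X) q e -> cobd g e = cobd J e.
  move=> Le; apply: eq_cobd => e' e'e _; rewrite /g ifN //.
  by apply: contra (link_notin Le); apply: mem_subseq.
(* If [c] contains [x], so do all its faces but one, and [g] vanishes on them. Otherwise the cocycle
   condition on [ins x c] gives the value. *)
have [xc|xc] := boolP (x \in c).
  have [q [e [pq Le ->]]] := chain_del Xc xc.
  rewrite (cobd_ins _ Le) /g ifN ?(link_notin Le) //.
  rewrite (eq_cobd (g := fun=> 0)) => [|e' _ _]; last by rewrite ins_mem mulr0.
  by rewrite cobd0 subr0 isgnK.
have Lc : chain_in (link x X) p c.
  have /and3P[sc oc Xc'] := Xc; apply/and3P; split=> //.
  apply/allP=> y yc; have Xy := allP Xc' y yc; rewrite /link Xy /=.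
  have /predU1P[yx|//] := cx _ Xy.
  by rewrite -yx yc in xc.
have := fX _ (chain_ins Xx Lc); rewrite (cobd_ins _ Lc).
move/(congr1 (fun a => isgn x c * a)); rewrite isgnK mulr0 => /eqP.
by rewrite subr_eq0 => /eqP ->; rewrite (JL _ _ Lc).
Qed.

(* Adding x to Y attaches a cone over the link of x. *)
Lemma acyclic_add X Y x p :
    X =1 predU1 x Y -> ~~ Y x -> acyclic Y p ->
    (forall q, p = q.+1 -> acyclic (link x Y) q) -> acyclic X p.
Proof.
move=> XE nYx aY aL f fX.
have Xx : X x by rewrite XE /= eqxx.
have YX : subpred Y X by move=> y Yy; rewrite XE /= Yy orbT.
have LE q c : chain_in (link x X) q c = chain_in (link x Y) q c.
  rewrite /chain_in; congr [&& _, _ & _]; apply: eq_all => y.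
  rewrite /link XE /=.
  by case: eqP => //= ->; rewrite ltxx (negbTE nYx).
have Ynx q c : chain_in Y q c -> x \notin c.
  by case/and3P=> _ _ Yc; apply: contra nYx => /(allP Yc).
have XY q c : chain_in X q c -> x \notin c -> chain_in Y q c.
  case/and3P=> sc oc Xc xc; apply/and3P; split=> //; apply/allP=> y yc.
  have := allP Xc y yc; rewrite XE /= => /predU1P[yx|//].
  by rewrite -yx yc in xc.
have LY q c : chain_in (link x X) q c -> chain_in Y q c.
  by rewrite LE; apply: chain_inS => y /andP[].
(* First [f] is changed by a coboundary to vanish on [Y]; the rest, [f1], lives on chains through
   [x]. *)
have [|g0 g0P] := aY f.
  by move=> c /(chain_inS YX); apply: fX.
pose g e := if x \in e then 0 else g0 e.
pose f1 e := f e - cobd g e.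
have f1Y c : chain_in Y p c -> f1 c = 0.
  move=> Yc; rewrite /f1 (g0P _ Yc) [cobd g c](eq_cobd (g := g0)) ?subrr //.
  move=> e ec _; rewrite /g ifN //.
  by apply: contra (Ynx _ _ Yc); apply: mem_subseq.
have f1X c : chain_in X p.+1 c -> cobd f1 c = 0.
  by move=> Xc; rewrite cobdB cobdK subr0 fX.
suff [h hP]: exists h, forall c, chain_in X p c -> f1 c = cobd h c.
  exists (fun e => h e + g e) => c Xc.
  have -> : cobd (fun e => h e + g e) c = cobd (fun e => h e - - g e) c.
    by apply: eq_cobd => e _ _; rewrite opprK.
  by rewrite cobdB cobdN opprK -hP // subrK.
(* For [p = 0] the only chain is empty and lies in [Y], so the link is not involved. *)
have [p0|[q pq]] : p = 0%N \/ exists q, p = q.+1.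
  by case: (p) => [|q]; [left | right; exists q].
  exists (fun=> 0) => c Xc; rewrite cobd0 f1Y //; apply: XY => //.
  by case/and3P: Xc; rewrite p0 => /nilP ->.
(* Removing [x] turns [f1] into a cocycle on the link; its primitive [e] is carried back to the
   chains through [x], with the minus sign of [cobd_ins]. *)
have [|e eP] := aL q pq (fun c => isgn x c * f1 (ins x c)).
  move=> c; rewrite -pq -LE => Lc.
  have := f1X _ (chain_ins Xx Lc); rewrite (cobd_ins _ Lc).
  move/(congr1 (fun a => isgn x c * a)); rewrite isgnK mulr0 f1Y; last exact: LY.
  by rewrite sub0r => /eqP; rewrite oppr_eq0 => /eqP.
pose h c := if x \in c then - (isgn x c * e [seq y <- c | y != x]) else 0.
exists h => c Xc; have [xc|xc] := boolP (x \in c); last first.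
  rewrite f1Y ?(XY _ _ Xc) // (eq_cobd (g := fun=> 0)) ?cobd0 // => e' e'c _.
  by rewrite /h ifN //; apply: contra xc; apply: mem_subseq.
have [q' [c' [pq' Lc ->]]] := chain_del Xc xc.
move: pq'; rewrite pq => -[qq]; rewrite -{q'}qq in Lc.
rewrite (cobd_ins _ Lc) /h ifN ?(link_notin Lc) // sub0r.
rewrite (eq_cobd (g := fun c => - e c)).
  by rewrite cobdN opprK -eP -?LE // isgnK.
move=> e' e'c se; rewrite ins_mem.
have ne' : x \notin e' by apply: contra (link_notin Lc); apply: mem_subseq.
have -> : isgn x (ins x e') = isgn x e'.
  rewrite /isgn /ins count_cat /= ltxx add0n -count_cat; congr (_ ^+ _).
  exact: (seq.permP (permEl (perm_filterC (fun y => (y < x)%O) e'))).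
have Le' : chain_in (link x X) (size e') e'.
  have /and3P[_ oc' Lc'] := Lc.
  rewrite /chain_in eqxx (subseq_sorted lt_trans e'c oc') /=.
  by apply/allP=> y /(mem_subseq e'c) /(allP Lc').
have -> : [seq y <- ins x e' | y != x] = e'.
  have /and3P[_ oi _] := chain_ins Xx Le'; have /and3P[_ oe' _] := Le'.
  apply: (irr_sorted_eq lt_trans ltxx) => // [|y].
    exact: (subseq_sorted lt_trans (filter_subseq _ _) oi).
  rewrite mem_filter mem_cat inE !mem_filter.
  by case: eqP => [->|_] /=; [exact/esym/negbTE | case: (y < x)%O; rewrite ?orbF].
by rewrite mulrN isgnK.
Qed.
End Cochains.
(** The elements of [s] are incomparable, so adding some of them leaves the links of the others
    unchanged. *)
Lemma acyclic_antichain d (T : porderType d) (F : comPzRingType)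
    (X Y : pred T) (s : seq T) p :
    X =1 predU (mem s) Y -> {in s, forall x, ~~ Y x} ->
    {in s &, forall x y, ~~ (x < y)%O} -> acyclic F Y p ->
    (forall x q, x \in s -> p = q.+1 -> acyclic F (link x Y) q) ->
  acyclic F X p.
Proof.
elim: s X => [|x s IH] X XE nY anti aY aL.
  by apply: eq_acyclic aY => y; rewrite XE.
pose X' := predU (mem s) Y.
have aX' : acyclic F X' p.
  apply: IH => //.
  - by move=> y ys; apply: nY; rewrite inE ys orbT.
  - by move=> y z ys zs; apply: anti; rewrite inE ?ys ?zs orbT.
  by move=> y q ys; apply: aL; rewrite inE ys orbT.
have [xs|xs] := boolP (x \in s).
  apply: eq_acyclic aX' => y; rewrite XE /= !inE.
  by case: eqP => // ->; rewrite xs.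
apply: (@acyclic_add _ _ _ X X' x) => //.
- by move=> y; rewrite XE /= !inE orbA.
- by rewrite negb_or xs nY ?mem_head.
move=> q pq; apply: eq_acyclic (aL x q (mem_head _ _) pq) => y.
rewrite /link /=; case: (boolP (y \in s)) => //= ys.
rewrite !(negbTE (anti _ _ _ _)) ?andbF ?inE ?eqxx ?ys ?orbT //.
Qed.

Lemma cobd_map (F : comPzRingType) d d' (T : porderType d)
    (U : porderType d') (h : T -> U) (f : seq U -> F) c :
  cobd f (map h c) = cobd (f \o map h) c.
Proof.
elim: c f => //= x c IH f; congr (_ - _).
by rewrite IH; apply: eq_cobd.
Qed.

Lemma acyclic_iso d d' (T : porderType d) (U : porderType d') (F : comPzRingType)
    (h : T -> U) (h' : U -> T) (X : pred T) (Y : pred U) p :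
    cancel h h' -> {mono h : x y / (x < y)%O} -> (forall x, Y (h x) = X x) ->
    (forall y, Y y -> h (h' y) = y) ->
  acyclic F X p -> acyclic F Y p.
Proof.
move=> hK hlt YX h'K aX f fY.
have chE q c : chain_in Y q (map h c) = chain_in X q c.
  rewrite /chain_in size_map sorted_map all_map; congr [&& _, _ & _].
    by apply: eq_sorted => x y; apply: hlt.
  by apply: eq_all => x /=.
have [|g gP] := aX (f \o map h).
  by move=> c Xc; rewrite -cobd_map fY // chE.
exists (g \o map h') => c Yc.
have cE : c = map h (map h' c).
  rewrite -map_comp map_id_in // => y yc /=; apply: h'K.
  by case/and3P: Yc => _ _ /allP; apply.
rewrite cE in Yc *; rewrite cobd_map; move: Yc; rewrite chE => Xc.
rewrite -/((f \o map h) (map h' c)) gP //.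
by apply: eq_cobd => e _ _ /=; rewrite mapK.
Qed.

(** * Subwords of a word *)

Section WordOrder.
Variable A : finType.

(** A separate name for [seq A], to carry the subword order as its order instance. *)
Definition word : predArgType := seq A.
HB.instance Definition _ := Choice.on word.

Let le_word : rel word := fun u v => subseq u v.
Let le_word_refl : reflexive le_word. Proof. exact: subseq_refl. Qed.
Let le_word_anti : antisymmetric le_word. Proof. exact: subseq_anti. Qed.
Let le_word_trans : transitive le_word. Proof. exact: subseq_trans. Qed.

HB.instance Definition _ := Order.Le_isPOrder.Build subword_display word
  le_word_refl le_word_anti le_word_trans.

Lemma le_wordE (u v : word) : (u <= v)%O = subseq u v. Proof. by []. Qed.
Lemma lt_wordE (u v : word) : (u < v)%O = subseq u v && (size u < size v)%N.
Proof.
rewrite lt_neqAle le_wordE andbC; apply: andb_id2l => uv.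
by rewrite ltn_neqAle (size_subseq uv) andbT (size_subseq_leqif uv).
Qed.

Definition subwords (w : word) r s : pred word :=
  fun u => (r <= size u <= s)%N && subseq u w.

Lemma subseq_cons_neq (a : A) (u v : seq A) :
  ohead u != Some a -> subseq u (a :: v) = subseq u v.
Proof.
case: u => [|b u]; rewrite ?sub0seq //= => nba; rewrite ifN //.
Qed.

(** Induction on the length of [w]. If [s] is that length, [w] is a cone point; if [r = 0], the
    empty word is one. *)
Lemma acyclic_subwords (F : comPzRingType) w r s p :
  (r <= s <= size w)%N -> (p <= s - r)%N -> acyclic F (subwords w r s) p.
Proof.
elim: {w}(size w) {-2}w (leqnn (size w)) r s p => [|N IH] w wN r s p;
  case/andP=> rs sw ps.
  apply: (@acyclic_cone _ word _ _ [::]).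
    by rewrite /subwords sub0seq andbT /=; lia.
  by move=> y; rewrite /subwords; case: y => // b y /andP[/= ? _]; lia.
case: (ltngtP s (size w)) sw => // [sw _|sw _]; last first.
  apply: (@acyclic_cone _ word _ _ w).
    by rewrite /subwords subseq_refl -sw rs leqnn.
  move=> y /andP[_ yw]; rewrite lt_wordE yw /= ltn_neqAle (size_subseq yw) andbT.
  by rewrite (size_subseq_leqif yw) orbA orbN.
case: r rs ps => [|r] rs ps.
  apply: (@acyclic_cone _ word _ _ [::]); first by rewrite /subwords sub0seq.
  by move=> y _; rewrite !lt_wordE sub0seq; case: y => //= b y; rewrite orbT.
case: s rs ps sw => [//|s] rs ps sw.
case: w wN sw => [//|a w] /= wN sw.
(* [D m] grows from the words starting with [a] ([m = 0]) to the whole poset ([m = s.+2]) by adding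
   the other words in order of length. *)
pose D m : pred word := fun u =>
  subwords (a :: w) r.+1 s.+1 u && ((ohead u == Some a) || (size u < m)%N).
suff aD m : (m <= s.+2)%N -> acyclic F (D m) p.
  apply: eq_acyclic (aD _ (leqnn _)) => u; rewrite /D /subwords.
  by case: (leqP (size u) s.+1) => us; rewrite ?andbF // ltnS us orbT andbT.
elim: m => [_|m IHm ms].
  (* Dropping the initial [a] shifts both length bounds by one. *)
  apply: (@acyclic_iso _ _ _ _ _ (cons a : word -> word) behead (subwords w r s)).
  - by [].
  - by move=> u v; rewrite !lt_wordE /= eqxx ltnS.
  - by move=> u; rewrite /D /subwords /= !eqxx /= ltnS andbT ltnS.
  - by move=> [|b u] /andP[_] //=; rewrite orbF => /eqP[->].
  - by apply: IH => //=; lia.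
pose L : seq word := [seq u <- map val (enum {: m.-tuple A}) | D m.+1 u && ~~ D m u].
have LP u : u \in L ->
    [/\ size u = m, subwords (a :: w) r.+1 s.+1 u & ohead u != Some a].
  rewrite mem_filter => /andP[/andP[/andP[Su Du] nDu] /mapP[t _ uE]].
  split=> //; first by rewrite uE size_tuple.
  by move: nDu; rewrite /D Su /= negb_or => /andP[].
apply: (@acyclic_antichain _ _ _ _ (D m) L).
- move=> u /=; rewrite mem_filter.
  have [Du|nDu] := boolP (D m u).
    rewrite orbT; move/andP: Du => [Su Du]; rewrite /D Su /=.
    by case/orP: Du => [->//|um]; rewrite ltnS (ltnW um) orbT.
  rewrite andbT orbF; have [Du|//] := boolP (D m.+1 u).
  have um : size u == m.
    move: nDu Du; rewrite /D; case: (subwords _ _ _ u) => //=.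
    by case: eqP => //= _; lia.
  apply/esym/mapP; exists (Tuple um) => //.
  by rewrite mem_enum.
- by move=> u; rewrite mem_filter => /andP[/andP[]].
- move=> u v /LP[su _ _] /LP[sv _ _].
  by rewrite lt_wordE su sv ltnn andbF.
- by apply: IHm; lia.
move=> x q /LP[sx Sx nx] pq.
have xw : subseq x w.
  by have /andP[_] := Sx; rewrite subseq_cons_neq.
have [ms'|sm] := ltnP m s.+1.
  (* Since [m <= s], the word [a :: x] is short enough. Any word of [D m] above [x] starts with [a],
     while [x] does not, so it contains [a :: x]. *)
  apply: (@acyclic_cone _ word _ _ (a :: x)).
    have axw : subseq (a :: x) (a :: w) by rewrite /= eqxx.
    rewrite /link /D /subwords !lt_wordE axw subseq_cons.
    rewrite [ohead _]/= [size (_ :: _)]/=.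
    by rewrite eqxx ltnSn orbT !andbT; move: Sx => /andP[]; lia.
  move=> y /andP[/andP[_ Dy]] /orP[yx|xy].
    by rewrite (lt_trans yx) ?orbT // lt_wordE subseq_cons /= ltnSn.
  move: xy; rewrite lt_wordE => /andP[xy sxy].
  case/orP: Dy => [|]; last by lia.
  case: y xy sxy => [//|b y] xy sxy /eqP[bE]; rewrite bE in xy *.
  rewrite subseq_cons_neq // in xy.
  rewrite !lt_wordE /= eqxx xy /= !ltnS.
  move: (size_subseq_leqif xy) => -[]; rewrite leq_eqVlt.
  case/orP=> [/eqP E|->]; last by rewrite !orbT.
  by rewrite E eqxx => /esym /eqP ->; rewrite eqxx.
(* At the top length [x] is maximal; its link consists of proper subwords of [x], which is itself a
   subword of [w]. *)
have {}sm : m = s.+1 by lia.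
apply: (@eq_acyclic _ _ _ (subwords x r.+1 s)); last by apply: IH; lia.
move=> y; rewrite /link /D /subwords !lt_wordE sx sm.
have [yx|yx] := boolP (subseq y x).
  have yw := subseq_trans yx xw.
  have yaw : subseq y (a :: w) by apply: subseq_trans yw (subseq_cons _ _).
  rewrite yaw !andbT /=.
  by case: (subseq x y); rewrite /=; lia.
by rewrite !andbF /=; case: (subseq x y); rewrite /= ?andbF //; lia.
Qed.

Lemma subseq_flatten (u : seq A) k :
  (size u <= k)%N -> subseq u (flatten (nseq k (enum A))).
Proof.
elim: k u => [|k IH] [|b u] //=; first by rewrite sub0seq.
rewrite ltnS => uk; rewrite -[b :: u]/([:: b] ++ u).
by rewrite cat_subseq ?IH // sub1seq mem_enum.
Qed.

Lemma acyclic_words (F : comPzRingType) r k p : (r <= k)%N -> (0 < #|A|)%N ->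
  (p <= k - r)%N -> acyclic F (fun u : word => (r <= size u <= k)%N) p.
Proof.
move=> rk A0 pk.
(* A word of length at most [k] takes one letter from each copy of the alphabet; [W] has length at
   least [k] because [A] is nonempty. *)
set W := flatten (nseq k (enum A)).
apply: (@eq_acyclic _ word F (subwords W r k)); last first.
  apply: acyclic_subwords pk; rewrite rk /= size_flatten /shape map_nseq.
  rewrite sumn_nseq -cardE.
  exact: leq_pmull.
move=> u; rewrite /subwords; case: (boolP (_ <= _ <= _)%N) => //= /andP[_ uk].
by rewrite subseq_flatten.
Qed.
End WordOrder.
(** Cochains on [U] become cochains on [T] through [pmap w], which inverts [map v]. *)
Lemma acyclic_embed d d' (T : porderType d) (U : porderType d')
    (F : comPzRingType) (v : U -> T) (w : T -> option U) (X : pred T) p :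
    pcancel v w -> {mono v : x y / (x < y)%O} -> (forall u, X (v u)) ->
    (forall x, X x -> omap v (w x) = Some x) ->
  acyclic F X p -> acyclic F predT p (T := U).
Proof.
move=> vK vlt Xv wK aX f fU.
have chE q c : chain_in X q (map v c) = chain_in predT q c.
  rewrite /chain_in size_map sorted_map all_map; congr [&& _, _ & _].
    by apply: eq_sorted => x y; apply: vlt.
  by apply: eq_all => x /=; apply: Xv.
have wvK : cancel (map v) (pmap w) by move=> c; rewrite map_pK.
have [c Xc|g gP] := aX (f \o pmap w).
  have cE : c = map v (pmap w c).
    have /and3P[_ _] := Xc; elim: (c) => //= x e IH /andP[/wK xE /IH {1}->].
    by case: (w x) xE => //= u [<-].
  rewrite cE cobd_map.
  rewrite cE chE in Xc.
  by rewrite (eq_cobd (g := f)) ?fU // => e _ _ /=; rewrite wvK.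
exists (g \o map v) => c Xc.
by rewrite -cobd_map -gP ?chE //= wvK.
Qed.

(** * Homology and the Hopf trace formula *)

Section Bridge.
Variables (d : Order.disp_t) (T : finPOrderType d) (F : fieldType).

(** Columns are functionals on chains. Read as cochains on sequences, they turn left multiplication
    by the boundary matrix into [cobd]. *)
Definition extend p (f : 'cV[F]_#|chain T p|) (c : seq T) : F :=
  if [pick e : chain T p | val (val e) == c] is Some e
  then f (enum_rank e) 0 else 0.

Lemma extendE p (f : 'cV[F]_#|chain T p|) (e : chain T p) :
  extend f (val (val e)) = f (enum_rank e) 0.
Proof.
rewrite /extend; case: pickP => [e' /eqP ee'|/(_ e)]; last by rewrite eqxx.
by have -> : e' = e by do 2!apply: val_inj.
Qed.

Lemma boundary_mxE p (f : 'cV[F]_#|chain T p|) (c : chain T p.+1) :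
  (boundary_mx T F p *m f) (enum_rank c) 0 = cobd (extend f) (val (val c)).
Proof.
pose s : seq T := val (val c).
rewrite cobdE -[RHS](big_mkord xpredT
  (fun a => (-1) ^+ a * extend f (take a s ++ drop a.+1 s))).
rewrite size_tuple big_mkord.
transitivity ((row (enum_rank c) (boundary_mx T F p) *m f) 0 0).
  by rewrite -row_mul [RHS]mxE.
rewrite rowK mulmx_suml summxE; apply: eq_bigr => a _.
rewrite -scalemxAl mxE -rowE mxE enum_rankK; congr (_ * _).
by rewrite -extendE.
Qed.

Lemma chain_inP p (c : seq T) :
  reflect (exists e : chain T p, val (val e) = c) (chain_in predT p c).
Proof.
apply: (iffP idP) => [/and3P[sc oc _]|[e <-]].
  by exists (exist _ (Tuple sc) oc).
by rewrite /chain_in size_tuple eqxx (valP e) all_predT.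
Qed.

Lemma boundary_mxK p : boundary_mx T F p.+1 *m boundary_mx T F p = 0.
Proof.
apply/matrixP=> j i; rewrite [RHS]mxE.
transitivity (col i (boundary_mx T F p.+1 *m boundary_mx T F p) j 0).
  by rewrite [RHS]mxE.
rewrite colE -mulmxA -[j]enum_valK boundary_mxE.
rewrite -[RHS](cobdK (extend (delta_mx i 0)) (val (val (enum_val j)))).
apply: eq_cobd => e ec se.
have /chain_inP[e' <-] : chain_in predT p.+1 e.
  by apply: chain_in_sub ec se; apply/chain_inP; exists (enum_val j).
by rewrite extendE -boundary_mxE.
Qed.

Lemma boundaries_cycles p : (boundaries T F p <= cycles T F p)%MS.
Proof.
rewrite genmxE; case: p => [|p] /=; first exact: submx1.
by apply/sub_kermxP/boundary_mxK.
Qed.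

(* Over a field the exactness of the chain complex is dual to that of the
   cochain complex: a cycle pairs to zero with every cocycle. *)
Lemma acyclic_cycles p :
  acyclic F (predT : pred T) p -> (cycles T F p <= boundaries T F p)%MS.
Proof.
move=> aT; rewrite genmxE submxE; apply/eqP.
(* The columns of the cokernel of the boundary matrix are cocycles. *)
suff zf (f : 'cV_#|chain T p|) :
    boundary_mx T F p *m f = 0 -> cycles T F p *m f = 0.
  apply/matrixP=> j i; rewrite [RHS]mxE; set M := _ *m _.
  transitivity (col i M j 0); first by rewrite [RHS]mxE.
  by rewrite colE -mulmxA zf ?mxE // mulmxA mulmx_coker mul0mx.
move=> Bf; have [c /chain_inP[e <-]|g gP] := aT (extend f).
  by rewrite -boundary_mxE Bf mxE.
(* For [p = 0] the cocycle is itself zero, as [cobd] is 0 on the empty chain. *)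
case: p f aT Bf gP => [|p] f aT Bf gP /=.
  rewrite mul1mx; apply/matrixP=> i j; rewrite ord1 -(enum_valK i) -extendE gP.
    have -> : val (val (enum_val i)) = [::].
      by apply: size0nil; rewrite size_tuple.
    by rewrite mxE.
  by apply/chain_inP; exists (enum_val i).
suff -> : f = boundary_mx T F p *m (\col_i g (val (val (enum_val i)))).
  by rewrite mulmxA mulmx_ker mul0mx.
apply/matrixP=> i j; rewrite ord1 -(enum_valK i) -extendE boundary_mxE gP; last first.
  by apply/chain_inP; exists (enum_val i).
apply: eq_cobd => e ec se.
have /chain_inP[e' <-] : chain_in predT p e.
  by apply: chain_in_sub ec se; apply/chain_inP; exists (enum_val i).
by rewrite extendE mxE enum_rankK.
Qed.
End Bridge.

Lemma acyclic_word_poset (F : fieldType) (A : finType) k r p :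
  (r <= k)%N -> (0 < #|A|)%N -> (p <= k - r)%N ->
  acyclic F (predT : pred (word_poset A k [pred s | (r <= s <= k)%N])) p.
Proof.
move=> rk A0 pk; set P := word_poset _ _ _.
pose v (u : P) : word A := val (val u).
apply: (@acyclic_embed _ _ (word A) P F v (fun x => obind insub (insub x))
  (fun u => (r <= size u <= k)%N)); last exact: acyclic_words.
- by move=> u; rewrite /v valK /= valK.
- move=> u u'; have vI : injective v by move=> x y /val_inj/val_inj.
  by rewrite !lt_neqAle (inj_eq vI).
- by move=> u; rewrite /v; exact: (valP u).
move=> x rx; have xk : (size x <= k)%N by case/andP: rx.
by rewrite (insubT (fun x => size x <= k)%N xk) /= insubT.
Qed.

(** * Traces on kernels, images and subquotients of modules *)

Section ReprTraces.
Variables (F : fieldType) (gT : finGroupType) (G : {group gT}).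

Lemma in_submodM n (U : 'M[F]_n) m1 m2 (X : 'M_(m1, m2)) (Y : 'M_(m2, n)) :
  in_submod U (X *m Y) = X *m in_submod U Y.
Proof. by rewrite in_submodE [in_submod U Y]in_submodE mulmxA. Qed.

(** First isomorphism theorem; the isomorphism [C] lifts a coset and applies [B]. *)
Lemma mx_rsim_factmod_im m n (rG1 : mx_representation F G m)
    (rG2 : mx_representation F G n) (B : 'M[F]_(m, n))
    (Kmod : mxmodule rG1 (kermx B)) (Imod : mxmodule rG2 <<B>>%MS) :
    (forall g, g \in G -> rG1 g *m B = B *m rG2 g) ->
  mx_rsim (factmod_repr Kmod) (submod_repr Imod).
Proof.
move=> homB; set K := kermx B; set I := <<B>>%MS.
pose C := in_submod I (val_factmod (1%:M : 'M_(\rank (cokermx K))) *m B).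
have sI m1 (W : 'M_(m1, m)) : (W *m B <= I)%MS by rewrite genmxE submxMl.
have killK m1 (W : 'M_(m1, m)) : val_submod (in_submod K W) *m B = 0.
  by apply/sub_kermxP; rewrite val_submodP.
have rK : \rank (cokermx K) = \rank I.
  by rewrite mxrank_coker mxrank_ker genmxE subKn // rank_leq_row.
exists C => // [|g Gg].
  rewrite /row_free mxrank_in_submod // -/(row_free _) -kermx_eq0.
  apply/rowV0P=> u /sub_kermxP; rewrite mulmxA -val_factmodE => uB.
  have : (val_factmod u <= K)%MS by apply/sub_kermxP.
  by rewrite -in_factmod_eq0 val_factmodK => /eqP.
pose W := val_factmod (1%:M : 'M_(\rank (cokermx K))) *m rG1 g.
have factW : val_factmod (factmod_repr Kmod g) = val_factmod (in_factmod K W).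
  by rewrite -val_factmodJ // mul1mx.
have -> : C *m submod_repr Imod g = in_submod I (W *m B).
  by rewrite -[LHS]in_submodJ // -mulmxA -homB // (mulmxA _ (rG1 g)).
have -> : factmod_repr Kmod g *m C
        = in_submod I (val_factmod (factmod_repr Kmod g) *m B).
  rewrite /C -in_submodM; congr (in_submod _ _).
  by rewrite [val_factmod (factmod_repr _ _)]val_factmodE -mulmxA.
congr (in_submod _ _); rewrite factW.
by rewrite -[in RHS](add_sub_fact_mod K W) mulmxDl killK add0r.
Qed.

Lemma mxtrace_ker_im m n (rG1 : mx_representation F G m)
    (rG2 : mx_representation F G n) (B : 'M[F]_(m, n))
    (Kmod : mxmodule rG1 (kermx B)) (Imod : mxmodule rG2 <<B>>%MS) :
    (forall g, g \in G -> rG1 g *m B = B *m rG2 g) ->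
  {in G, forall g, \tr (rG1 g)
    = \tr (submod_repr Kmod g) + \tr (submod_repr Imod g)}.
Proof.
move=> homB g Gg; rewrite -(mxtrace_sub_fact_mod Kmod).
by rewrite (mxtrace_rsim (mx_rsim_factmod_im Kmod Imod homB)).
Qed.

Lemma mx_rsim_section0 n (rG : mx_representation F G n) (U V : 'M[F]_n)
    (modU : mxmodule rG U) (modV : mxmodule rG V) :
  U = 0 -> mx_rsim (section_repr modU modV) (submod_repr modV).
Proof.
move=> U0; apply: mx_rsim_sym; set W := <<in_factmod U V>>%MS.
pose C := in_submod W (in_factmod U (val_submod (1%:M : 'M_(\rank V)))).
have sW : (in_factmod U (val_submod (1%:M : 'M_(\rank V))) <= W)%MS.
  rewrite genmxE [in_factmod U _]in_factmodE [in_factmod U V]in_factmodE.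
  by rewrite submxMr // val_submodP.
have rfact m (X : 'M_(m, n)) : \rank (in_factmod U X) = \rank X.
  have rU : \rank U = 0%N by rewrite U0 mxrank0.
  have rUX : \rank (U + X)%MS = \rank X by rewrite U0 adds0mx.
  by rewrite -rUX -mxrank_in_factmod rU addn0.
have rW : \rank V = \rank W by rewrite genmxE rfact.
exists C => // [|g Gg].
  by rewrite /row_free mxrank_in_submod // rfact val_submod1.
have -> : C *m section_repr modU modV g
        = in_submod W (in_factmod U (val_submod (1%:M *m submod_repr modV g))).
  by rewrite val_submodJ // in_factmodJ // -[LHS]in_submodJ.
rewrite mul1mx -in_submodM; congr (in_submod _ _).
by rewrite [RHS]in_factmodE [in LHS]in_factmodE [in RHS]val_submodE !mulmxA.
Qed.

Lemma section_sub0 n (U V : 'M[F]_n) :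
  (V <= U)%MS -> \rank <<in_factmod U V>>%MS = 0%N.
Proof. by move=> VU; apply/eqP; rewrite genmxE mxrank_eq0 in_factmod_eq0. Qed.

End ReprTraces.

Lemma mxtrace_act (F : fieldType) (gT : finGroupType) (X : finType)
    (to : {action gT &-> X}) g :
  \tr (act_repr F to g) = #|[set x | to x g == x]|%:R.
Proof.
rewrite /mxtrace (reindex_onto enum_rank enum_val) /=; last first.
  by move=> i _; rewrite enum_valK.
have -> : #|[set x | to x g == x]|%:R = \sum_x (to x g == x)%:R :> F.
  rewrite -sum1dep_card natr_sum big_mkcond.
  by apply: eq_bigr => x _; case: eqP.
apply: eq_big => [x|x _]; first by rewrite enum_rankK eqxx.
by rewrite !mxE enum_rankK (inj_eq enum_rank_inj) eq_sym.
Qed.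

Section HopfTrace.
Variables (d : Order.disp_t) (T : finPOrderType d) (F : fieldType).
Variables (gT : finGroupType) (to : {action gT &-> T}).
Hypothesis to_mono : forall g, {homo to^~ g : x y / (x < y)%O}.
Let rho p := chain_repr F to_mono p.

(** Modulo the cycles on [q.+1] vertices, the chains there are the boundaries on [q] vertices. By
    acyclicity these are all the cycles, so the traces telescope. *)
Lemma mxtrace_cycles q p g :
    (forall j, (j < p)%N -> acyclic F (predT : pred T) j) -> (q <= p)%N ->
  \tr (submod_repr (cycles_module F to_mono q) g)
    = (-1) ^+ q * \sum_(j < q.+1) (-1) ^+ j * \tr (rho j g).
Proof.
move=> aT; elim: q => [_|q IH qp].
  rewrite expr0 mul1r big_ord_recl big_ord0 addr0 mul1r.
  by apply: (mxtrace_rsim (G := [set: gT])); rewrite ?inE //; apply: rsim_submod1.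
have := @mxtrace_ker_im F gT [set: gT]%G _ _ (rho q.+1) (rho q)
  (boundary_mx T F q) (cycles_module F to_mono q.+1)
  (boundaries_module F to_mono q) _ g (in_setT g).
move=> /(_ (fun g _ => boundary_mxJ F to_mono q g)) E.
rewrite big_ord_recr /= mulrDr signrMK exprS mulN1r mulNr -IH; last exact: ltnW.
have <- : \tr (submod_repr (boundaries_module F to_mono q) g)
        = \tr (submod_repr (cycles_module F to_mono q) g).
  apply: (mxtrace_rsim (G := [set: gT])); rewrite ?inE //.
  apply/mx_rsim_iso/eqmx_iso.
  by apply/eqmxP; rewrite boundaries_cycles (acyclic_cycles (aT _ qp)).
by rewrite /rho E addrC addrK.
Qed.

End HopfTrace.
(** * Counting chains of words *)

Lemma mul_bin_trans k i j : (j <= i <= k)%N ->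
  ('C(k, i) * 'C(i, j) = 'C(k, j) * 'C(k - j, i - j))%N.
Proof.
move=> /andP[ji ik].
(* Multiplied by this product, both sides become the factorial of [k]. *)
have p : (0 < j`! * (i - j)`! * (k - i)`!)%N by rewrite !muln_gt0 !fact_gt0.
apply/eqP; rewrite -(eqn_pmul2r p); apply/eqP.
have E1 := bin_fact ji; have E2 := bin_fact ik.
have E3 := bin_fact (leq_trans ji ik); have E4 := bin_fact (leq_sub2r j ik).
have kij : (k - j - (i - j) = k - i)%N by lia.
rewrite kij in E4; transitivity k`!.
  by rewrite -E2 -E1; ring.
by rewrite -E3 -E4; ring.
Qed.

Section Counting.
Variable F : comNzRingType.
Implicit Type x : F.

Lemma sum_bin_bin k j x : (j <= k)%N ->
  \sum_(i < k.+1) ('C(k, i) * 'C(i, j))%:R * x ^+ i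
    = 'C(k, j)%:R * x ^+ j * (1 + x) ^+ (k - j).
Proof.
move=> jk; rewrite exprDn mulr_sumr.
rewrite -(big_mkord xpredT (fun i => ('C(k, i) * 'C(i, j))%:R * x ^+ i)).
rewrite (big_cat_nat (n := j)) //=; last exact: leqW.
rewrite big_nat_cond big1 ?add0r => [|i /andP[/andP[_ ij] _]]; last first.
  by rewrite (bin_small ij) muln0 mul0r.
rewrite -[X in index_iota X _]add0n big_addn subSn // big_mkord.
apply: eq_bigr => i _.
rewrite expr1n mul1r mul_bin_trans; last by have := ltn_ord i; lia.
by rewrite addnK natrM exprD -mulr_natr; ring.
Qed.

(** For [m = k - r] the right side is, up to sign, the alternating count of chains in
    [altchains_words]. Induction on [m]: by Pascal's rule the sums for [m] and [m.+1] add up to one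
    that [sum_bin_bin] evaluates. *)
Lemma sum_bin_pred k m x : (m < k)%N ->
  \sum_(1 + m <= i < k.+1) ('C(k, i) * 'C(i.-1, m))%:R * x ^+ i
    = (-1) ^+ m.+1 * (1 - \sum_(k - m <= l < k.+1)
                             (1 + x) ^+ l * ((- x) ^+ (k - l) * 'C(k, l)%:R)).
Proof.
pose Rn n i := ('C(k, i) * 'C(i.-1, n))%:R * x ^+ i.
pose w l := (1 + x) ^+ l * ((- x) ^+ (k - l) * 'C(k, l)%:R).
rewrite -/(Rn m) -/w.
(* The added terms vanish, so sums for different [n] share the range from 1. Index 0 stays out,
   since [i.-1] is truncated there. *)
have ext n : (n < k)%N ->
    \sum_(1 + n <= i < k.+1) Rn n i = \sum_(1 <= i < k.+1) Rn n i.
  move=> nk; rewrite [RHS](big_cat_nat (n := 1 + n)) //=; last by lia.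
  rewrite [X in _ = X + _]big_nat_cond [X in _ = X + _]big1 ?add0r //.
  move=> i /andP[/andP[i0 ij] _].
  by rewrite /Rn ['C(i.-1, n)]bin_small ?muln0 ?mul0r //; lia.
have full j : (j <= k)%N -> ('C(0, j))%:R
      + \sum_(1 <= i < k.+1) ('C(k, i) * 'C(i, j))%:R * x ^+ i
     = 'C(k, j)%:R * x ^+ j * (1 + x) ^+ (k - j).
  move=> jk; rewrite -(sum_bin_bin x jk).
  rewrite -(big_mkord xpredT (fun i => ('C(k, i) * 'C(i, j))%:R * x ^+ i)).
  by rewrite [RHS]big_ltn // bin0 mul1n mulr1.
elim: m => [k0|m IH mk]; last have {}IH := IH (ltnW mk).
  rewrite subn0 big_nat1 /w subnn expr0 binn mulr1 mulr1 expr1 mulN1r opprB.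
  have := full 0 (leq0n k); rewrite !bin0 expr0 subn0 !mul1r => <-.
  by rewrite addrC addKr; apply: eq_bigr => i _; rewrite /Rn !bin0.
have mk' : (m < k)%N by apply: ltnW.
rewrite (ext _ mk) -(addrK (\sum_(1 <= i < k.+1) Rn m i) (bigop _ _ _)).
rewrite -big_split /= -(ext _ mk') IH.
pose F2 i := ('C(k, i) * 'C(i, m.+1))%:R * x ^+ i.
rewrite (eq_big_nat _ _ (F2 := F2)); last first.
  by case=> // i _; rewrite /Rn /F2 /= binS mulnDr natrD mulrDl.
have := full m.+1 (ltnW mk); rewrite bin0n add0r => ->.
have -> : \sum_(k - m.+1 <= l < k.+1) w l
   = (1 + x) ^+ (k - m.+1) * ((- x) ^+ m.+1 * 'C(k, m.+1)%:R)
     + \sum_(k - m <= l < k.+1) w l.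
  have km : (k - m.+1 < k.+1)%N by lia.
  by rewrite (big_ltn km) {1}/w subnSK // bin_sub ?subKn // ltnW.
rewrite [(- x) ^+ m.+1]exprNn; have := sqrr_sign F m.+1; set e := (-1) ^+ m.+1.
rewrite [(-1) ^+ m.+2]exprS -/e; set S := bigop _ _ _ => e2.
pose y := 'C(k, m.+1)%:R * x ^+ m.+1 * (1 + x) ^+ (k - m.+1).
rewrite -/y; transitivity (e ^+ 2 * y - e * (1 - S)).
  by rewrite e2 mul1r.
by rewrite /y; ring.
Qed.

(* The number of words of length l over 1 + x letters that contain a given word
   of length j: the first letter either is the first letter of that word or one
   of the x others. *)
Fixpoint superwords x j l : F :=
  match j, l with
  | 0, _ => (1 + x) ^+ l
  | j'.+1, 0 => 0
  | j'.+1, l'.+1 => superwords x j' l' + x * superwords x j l'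
  end.

Lemma superwords0 x l : superwords x 0 l = (1 + x) ^+ l.
Proof. by case: l. Qed.

Lemma superwords_small x j l : (l < j)%N -> superwords x j l = 0.
Proof.
elim: j l => [|j IH] [|l] //=; rewrite ltnS => lj.
rewrite IH // add0r.
elim: l lj => [|l IHl] lj /=; first by rewrite mulr0.
by rewrite IH ?(ltnW lj) // add0r IHl ?mulr0 // ltnW.
Qed.

Lemma superwords_diag x j : superwords x j j = 1.
Proof. by elim: j => [|j IH] //=; rewrite IH superwords_small // mulr0 addr0. Qed.

(** This inverts the counting of superwords. The recursion and Pascal's rule give the induction on
    [k]; for [j = 0] it is the binomial expansion of a power of [(1 + x) - x]. *)
Lemma sum_superwords x j k :
  \sum_(l < k.+1) superwords x j l * ((- x) ^+ (k - l) * 'C(k, l)%:R)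
    = (j <= k)%N%:R.
Proof.
elim: k j => [|k IH] [|j].
- by rewrite big_ord_recl big_ord0 /= expr0 !mulr1 addr0.
- by rewrite big_ord_recl big_ord0 /= mul0r addr0.
- rewrite leq0n -[RHS](expr1n _ k.+1) -{2}(addrK x 1) exprDn /=.
  rewrite (reindex_inj rev_ord_inj) /=; apply: eq_bigr => i _.
  have ik : (i <= k.+1)%N by rewrite -ltnS.
  by rewrite superwords0 subSS subKn // bin_sub // mulrA mulr_natr.
rewrite big_ord_recl /= mul0r add0r.
pose w i l := superwords x i l * ((- x) ^+ (k - l) * 'C(k, l)%:R).
rewrite (eq_bigr (fun l : 'I_k.+1 =>
  - x * w j.+1 l.+1 + (w j l + x * w j.+1 l))) => [|l _].
  rewrite !big_split /= -!mulr_sumr !IH ltnS.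
  rewrite big_ord_recr /= {2}/w (bin_small (ltnSn k)) !mulr0 addr0.
  suff -> : \sum_(l < k) w j.+1 l.+1 = (j < k)%N%:R by ring.
  by rewrite -IH big_ord_recl /= mul0r add0r.
rewrite /w /bump /= add1n subSS binS natrD.
have [lk|lk] := ltnP l k; last first.
  by rewrite (bin_small (leq_ltn_trans lk (ltnSn _)))%N /=; ring.
by rewrite -(subnSK lk) exprS; ring.
Qed.

End Counting.

(** * Alternating counts of chains *)

Lemma sum_tuple0 (T : finType) (V : nmodType) (P : pred (seq T))
    (f : seq T -> V) :
  P [::] -> \sum_(t : 0.-tuple T | P t) f t = f [::].
Proof.
move=> P0; rewrite (big_pred1 [tuple]) // => t.
by rewrite (tuple0 t) /= eqxx; exact: P0.
Qed.

Lemma sum_tupleS (T : finType) (V : nmodType) n (P : pred (seq T))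
    (f : seq T -> V) :
  \sum_(t : n.+1.-tuple T | P t) f t
    = \sum_x \sum_(t : n.-tuple T | P (x :: t)) f (x :: t).
Proof.
rewrite pair_big_dep /=.
rewrite (reindex (fun p : T * n.-tuple T => [tuple of p.1 :: p.2])) //=.
exists (fun t : n.+1.-tuple T => (thead t, [tuple of behead t])) => [[x t] _|t _].
  by congr (_, _); apply: val_inj.
by rewrite -tuple_eta.
Qed.

Section ChainCount.
Variables (d : Order.disp_t) (T : finPOrderType d) (F : comNzRingType).
Variable X : pred T.

Definition nchains q : F := \sum_(c : q.-tuple T | sorted <%O c && all X c) 1.
Definition nchains_above q (w : T) : F :=
  \sum_(c : q.-tuple T | path <%O w c && all X c) 1.
(** For large [n] this is, up to sign, the reduced Euler characteristic of the part of [X] above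
    [w]. *)
Definition altchains_above n w := \sum_(q < n) (-1) ^+ q * nchains_above q w.

(** The empty chain counts 1; any other chain is its least vertex [x] followed by a chain above
    [x]. *)
Lemma altchains_aboveS n w :
  altchains_above n.+1 w
    = 1 - \sum_(x | X x && (w < x)%O) altchains_above n x.
Proof.
rewrite /altchains_above big_ord_recl expr0 mul1r exchange_big /= -sumrN.
congr (_ + _).
  exact: (@sum_tuple0 _ _ (fun c => path <%O w c && all X c) (fun=> 1)).
apply: eq_bigr => q _; rewrite /bump /= add1n exprS mulN1r mulNr -mulr_sumr.
congr (- (_ * _)).
rewrite /nchains_above.
rewrite (@sum_tupleS _ _ _ (fun c => path <%O w c && all X c) (fun=> 1)) /=.
rewrite [RHS]big_mkcond; apply: eq_bigr => x _ /=.
case: (X x); case: (w < x)%O => //=; rewrite big_pred0 // => c; exact: andbF.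
Qed.

Lemma altchainsS n : \sum_(q < n.+1) (-1) ^+ q * nchains q
    = 1 - \sum_(x | X x) altchains_above n x.
Proof.
rewrite big_ord_recl expr0 mul1r exchange_big /= -sumrN.
congr (_ + _).
  exact: (@sum_tuple0 _ _ (fun c => sorted <%O c && all X c) (fun=> 1)).
apply: eq_bigr => q _; rewrite /bump /= add1n exprS mulN1r mulNr -mulr_sumr.
congr (- (_ * _)).
rewrite /nchains.
rewrite (@sum_tupleS _ _ _ (fun c => sorted <%O c && all X c) (fun=> 1)) /=.
rewrite [RHS]big_mkcond; apply: eq_bigr => x _ /=.
case: (X x) => //=; rewrite big_pred0 // => c; exact: andbF.
Qed.
End ChainCount.

Section WordCount.
Variables (F : comNzRingType) (A : finType) (B : pred A).
Let b : F := #|B|%:R - 1.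

Let bE : 1 + b = #|B|%:R. Proof. by rewrite /b addrC subrK. Qed.

Lemma sum_words l : \sum_(t : l.-tuple A | all B t) 1 = (1 + b) ^+ l.
Proof.
elim: l => [|l IH].
  by rewrite (@sum_tuple0 _ _ (all B) (fun=> 1)).
rewrite (@sum_tupleS _ _ _ (all B) (fun=> 1)) exprS {1}bE -sum1_card natr_sum.
rewrite mulr_suml [RHS]big_mkcond; apply: eq_bigr => x _ /=.
rewrite -[x \in B]/(B x); case: (B x); first by rewrite IH mul1r.
by rewrite big_pred0.
Qed.

(** Greedy matching from the left: a first letter [a] is used up, while each of the [b] other
    letters of [B] leaves all of [a :: w] to be found. *)
Lemma sum_superwords_over (w : seq A) l : all B w ->
  \sum_(t : l.-tuple A | all B t && subseq w t) 1 = superwords b (size w) l.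
Proof.
elim: l w => [|l IH] [|a w] //=.
- by rewrite (@sum_tuple0 _ _ (fun t => all B t && subseq [::] t) (fun=> 1)).
- move=> _; rewrite big_pred0 // => t.
  by rewrite !tuple0 andbF.
- move=> _; rewrite -sum_words; apply: eq_bigl => t.
  by rewrite sub0seq andbT.
case/andP=> Ba Bw.
rewrite (@sum_tupleS _ _ _ (fun t => all B t && subseq (a :: w) t) (fun=> 1)) /=.
rewrite (bigD1 a) //= Ba eqxx IH //; congr (_ + _).
transitivity (\sum_(i | B i && (i != a)) superwords b (size w).+1 l).
  rewrite big_mkcond [RHS]big_mkcond; apply: eq_bigr => i _.
  case: eqP => [->|/eqP ia]; rewrite ?andbF //=.
  rewrite eq_sym (negbTE ia) andbT; case: (B i) => /=; last by rewrite big_pred0.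
  by rewrite IH //= Ba.
rewrite sumr_const -mulr_natl; congr (_ * _).
have : #|B| = #|[pred i | B i && (i != a)]|.+1.
  rewrite (cardD1 a) [a \in B]Ba; congr (1 + _)%N.
  by apply: eq_card => i; rewrite !inE andbC.
by rewrite /b => ->; rewrite -addn1 natrD addrK.
Qed.

Variables (r k : nat).
Local Notation P := (word_poset A k [pred s | (r <= s <= k)%N]).
Let X (u : P) := all B (val u).

Lemma sum_word_poset (Q : pred (seq A)) (G : seq A -> F) :
  \sum_(u : P | Q (val (val u))) G (val (val u))
    = \sum_(r <= l < k.+1) \sum_(t : l.-tuple A | Q t) G t.
Proof.
rewrite big_geq_mkord /=.
rewrite (partition_big (fun u : P => inord (size (val (val u))) : 'I_k.+1)
  (fun l : 'I_k.+1 => r <= l)%N); last first.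
  move=> u _; have /andP[ru uk] := valP u.
  by rewrite inordK // ltnS.
apply: eq_bigr => l rl.
have lk : (r <= l <= k)%N by rewrite rl -ltnS ltn_ord.
have tk (t : l.-tuple A) : (size t <= k)%N by rewrite size_tuple; case/andP: lk.
have tr (t : l.-tuple A) : [pred s | (r <= s <= k)%N] (size (Bseq (tk t))).
  by rewrite /= size_tuple.
rewrite (reindex_omap (fun t : l.-tuple A => exist _ (Bseq (tk t)) (tr t) : P)
   (fun u => insub (val (val u)))) /=; last first.
  move=> u /andP[_ /eqP ul]; have /andP[ru uk] := valP u.
  have sl : size (val (val u)) == l by rewrite -ul inordK.
  by rewrite insubT /=; congr Some; do 2!apply: val_inj.
apply: eq_bigl => t; rewrite size_tuple inord_val eqxx andbT.
by rewrite valK eqxx andbT.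
Qed.

(* The reduced Euler characteristic (up to sign) of the words of length at most
   k properly containing a given word of length l. *)
Definition chain_weight (l : nat) : F := (- b) ^+ (k - l) * 'C(k, l)%:R.

(** The weights satisfy the recursion of [altchains_aboveS] by [sum_superwords]. The bound on [n]
    ensures that no chain above [w] is cut off. *)
Lemma altchains_above_words n (w : P) : X w -> (k - size (val (val w)) < n)%N ->
  altchains_above F X n w = chain_weight (size (val (val w))).
Proof.
elim: n w => // n IH w Xw kwn; rewrite altchains_aboveS.
set j := size _ in kwn *; have /andP[rj jk] : (r <= j <= k)%N := valP w.
rewrite (eq_bigr (fun u : P => chain_weight (size (val (val u))))); last first.
  move=> u /andP[Xu]; rewrite lt_neqAle => /andP[neq le]; apply: IH => //.
  have jl : (j < size (val (val u)))%N.
    rewrite ltn_neqAle size_subseq // andbT.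
    by rewrite (size_subseq_leqif (le : subseq _ _)) val_eqE.
  have /andP[_ uk] : (r <= size (val (val u)) <= k)%N := valP u.
  by move: kwn; rewrite -/j; lia.
pose Q (t : seq A) := [&& all B t, subseq (val (val w)) t & j < size t]%N.
rewrite (eq_bigl (fun u : P => Q (val (val u)))); last first.
  move=> u; rewrite /Q; congr (_ && _).
  rewrite lt_neqAle andbC; apply: andb_id2l => le.
  rewrite ltn_neqAle size_subseq // andbT; congr (~~ _).
  by rewrite (size_subseq_leqif (le : subseq _ _)) val_eqE.
rewrite (sum_word_poset Q (fun t => chain_weight (size t))).
have := sum_superwords b j k; rewrite jk.
have jk1 : (j < k.+1)%N by [].
(* The only superword of length [j] is [w] itself; its weight is the value sought. *)
rewrite (bigD1 (Ordinal jk1)) //= superwords_diag mul1r => /esym S.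
rewrite [X in X - _](S : 1 = _); apply/eqP; rewrite subr_eq; apply/eqP.
congr (_ + _); apply: esym.
rewrite big_geq_mkord big_mkcond [RHS]big_mkcond; apply: eq_bigr => l _ /=.
have [rl|lr] := leqP r l; last first.
  by case: eqP => // _; rewrite superwords_small ?mul0r //; apply: leq_trans lr rj.
rewrite (eq_bigl (fun t : l.-tuple A =>
  (j < l)%N && (all B t && subseq (val (val w)) t))); last first.
  by move=> t; rewrite /Q size_tuple; case: (j < l)%N; rewrite ?andbT ?andbF.
rewrite -(inj_eq val_inj) /=; have [jl|lj|<-] := ltngtP j l; last first.
- by rewrite big_pred0 // => t; rewrite ltnn.
- by rewrite big_pred0 ?superwords_small ?mul0r // => t.
rewrite -sum_superwords_over // mulr_suml; apply: eq_bigr => t _.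
by rewrite mul1r size_tuple.
Qed.

Lemma altchains_words : (r <= k)%N ->
  \sum_(q < (k - r).+2) (-1) ^+ q * nchains F X q
    = 1 - \sum_(r <= l < k.+1) (1 + b) ^+ l * chain_weight l.
Proof.
move=> rk; rewrite altchainsS; congr (_ - _).
rewrite (eq_bigr (fun u : P => chain_weight (size (val (val u))))); last first.
  move=> u Xu; apply: altchains_above_words => //.
  have /andP[ru _] : (r <= size (val (val u)) <= k)%N := valP u.
  by lia.
rewrite (sum_word_poset (all B) (fun t => chain_weight (size t))).
apply: eq_bigr => l _; rewrite -sum_words mulr_suml; apply: eq_bigr => t _.
by rewrite mul1r size_tuple.
Qed.
End WordCount.
(** * Characters determine representations in characteristic zero *)

(** Factor [E] through its rank as [C *m R]; idempotence forces [R *m C = 1], and the trace is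
    cyclic. *)
Lemma mxtrace_idem (F : fieldType) n (E : 'M[F]_n) :
  E *m E = E -> \tr E = (\rank E)%:R.
Proof.
move=> EE; have CR := mulmx_base E.
have [X XC] := row_fullP (col_base_full E).
have [Y RY] := row_freeP (row_base_free E).
have RC : row_base E *m col_base E = 1%:M.
  have : X *m ((col_base E *m row_base E) *m (col_base E *m row_base E)) *m Y
       = X *m (col_base E *m row_base E) *m Y by rewrite CR EE.
  move: (col_base E) (row_base E) XC RY => C R XC RY.
  by rewrite !mulmxA XC !mul1mx -!mulmxA RY !mulmx1.
by rewrite -{1}CR mxtrace_mulC RC mxtrace1.
Qed.

Section CharacterZero.
Variables (F : fieldType) (gT : finGroupType) (G : {group gT}).
Hypothesis F0 : [pchar F] =i pred0.

Section HomRepr.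
Variables (m n : nat).
Variables (rG1 : mx_representation F G m) (rG2 : mx_representation F G n).

(** On flattened matrices; the fixed points of all [hom_mx g] are the intertwining matrices. *)
Definition hom_mx (g : gT) : 'M[F]_(m * n) :=
  lin_mx (mulmx (rG1 g^-1%g) \o mulmxr (rG2 g)).

Lemma hom_mx_repr : mx_repr G hom_mx.
Proof.
split=> [|g h Gg Gh]; apply/row_matrixP=> i; rewrite !rowE.
  rewrite mul_rV_lin /= invg1 !repr_mx1 mul1mx mulmx1 vec_mxK.
  by rewrite mulmx1.
rewrite mulmxA !mul_rV_lin /= mxvecK invMg !repr_mxM ?groupV //.
by rewrite !mulmxA.
Qed.

Lemma mxtrace_hom g : \tr (hom_mx g) = \tr (rG1 g^-1%g) * \tr (rG2 g).
Proof.
rewrite /mxtrace mulr_suml (reindex _ (curry_mxvec_bij m n)) /=.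
under [RHS]eq_bigr do rewrite mulr_sumr.
rewrite pair_big; apply: eq_bigr => -[i j] _ /=.
transitivity (row (mxvec_index i j) (hom_mx g) 0 (mxvec_index i j)).
  by rewrite [RHS]mxE.
rewrite rowE -mxvec_delta mul_vec_lin mxvecE /= -(mul_delta_mx (0 : 'I_1) i j).
by rewrite -mulmxA -rowE mulmxA -colE mxE big_ord1 !mxE.
Qed.

Definition hom_avg := #|G|%:R^-1 *: \sum_(g in G) hom_mx g.

Let nG : #|G|%:R != 0 :> F.
Proof. by move/pcharf0P: F0 => ->; rewrite -lt0n cardG_gt0. Qed.

Lemma hom_avgJ h : h \in G -> hom_avg *m hom_mx h = hom_avg.
Proof.
move=> Gh; rewrite -scalemxAl; congr (_ *: _); rewrite mulmx_suml.
rewrite [RHS](reindex_acts 'R _ Gh) ?astabsR //=; apply: eq_bigr => g Gg.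
by case: hom_mx_repr => _ ->.
Qed.

Lemma hom_avg_idem : hom_avg *m hom_avg = hom_avg.
Proof.
rewrite {2}/hom_avg -scalemxAr mulmx_sumr.
rewrite (eq_bigr (fun=> hom_avg)) => [|h Gh]; last exact: hom_avgJ.
by rewrite sumr_const -scaler_nat scalerA mulVf ?scale1r.
Qed.

Lemma mxrank_hom_avg :
  \sum_(g in G) \tr (rG1 g^-1%g) * \tr (rG2 g) = #|G|%:R * (\rank hom_avg)%:R.
Proof.
rewrite -(mxtrace_idem hom_avg_idem) mxtraceZ mulrA mulfV // mul1r.
rewrite [RHS]linear_sum /=.
by apply: eq_bigr => g _; rewrite mxtrace_hom.
Qed.

Lemma hom_avg_hom : hom_avg != 0 ->
  exists2 f : 'M_(m, n), f != 0 & forall g, g \in G -> rG1 g *m f = f *m rG2 g.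
Proof.
move=> nz; have [i nzi] : exists i, row i hom_avg != 0.
  apply/existsP; apply: contraR nz => /existsPn z.
  apply/eqP/row_matrixP=> i.
  by rewrite row0; apply/eqP; rewrite -[_ == _]negbK z.
exists (vec_mx (row i hom_avg)) => [|g Gg].
  by apply: contra nzi => /eqP z; rewrite -(vec_mxK (row i _)) z linear0.
have := congr1 vec_mx (congr1 (row i) (hom_avgJ Gg)).
rewrite row_mul mul_rV_lin /= mxvecK => E.
by rewrite -{1}E !mulmxA -repr_mxM ?groupV // mulgV repr_mx1 mul1mx.
Qed.

End HomRepr.

(** The identity matrix is a nonzero fixed point. *)
Lemma hom_avg_neq0 n (rG : mx_representation F G n) :
  (0 < n)%N -> hom_avg rG rG != 0.
Proof.
move=> n0; apply: contraTneq (oner_neq0 F) => z.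
have fix1 g : g \in G -> mxvec 1%:M *m hom_mx rG rG g = mxvec 1%:M.
  by move=> Gg; rewrite mul_vec_lin /= mul1mx -repr_mxM ?groupV // mulVg repr_mx1.
have : mxvec 1%:M *m hom_avg rG rG = mxvec (1%:M : 'M_n).
  rewrite -scalemxAr mulmx_sumr (eq_bigr _ fix1) sumr_const -scaler_nat scalerA.
  by rewrite mulVf ?scale1r //; move/pcharf0P: F0 => ->; rewrite -lt0n cardG_gt0.
rewrite z mulmx0 => /(congr1 vec_mx); rewrite mxvecK linear0.
case: n n0 rG z fix1 => // n _ rG z fix1 /matrixP/(_ 0 0).
by rewrite !mxE eqxx /= => /esym E; rewrite -[1]/(1 *+ true) E eqxx.
Qed.

Lemma mx_rsim_trace m n (rG1 : mx_representation F G m)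
    (rG2 : mx_representation F G n) :
  {in G, forall g, \tr (rG1 g) = \tr (rG2 g)} -> mx_rsim rG1 rG2.
Proof.
have natI (i j : nat) : i%:R = j%:R :> F -> i = j.
  wlog ij : i j / (i <= j)%N => [IH|].
    by case/orP: (leq_total i j) => ij E; [|apply: esym]; apply: IH.
  move/esym/eqP; rewrite -subr_eq0 -natrB //; move/pcharf0P: F0 => ->.
  by rewrite subn_eq0 => ji; apply/eqP; rewrite eqn_leq ij.
have dim m' n' (r1 : mx_representation F G m') (r2 : mx_representation F G n') :
    {in G, forall g, \tr (r1 g) = \tr (r2 g)} -> m' = n'.
  by move/(_ 1%g (group1 G)); rewrite !repr_mx1 !mxtrace1 => /natI.
have [N] := ubnP m; elim: N => // N IH in m n rG1 rG2 *; rewrite ltnS => mN tr12.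
have mn := dim _ _ _ _ tr12.
case: (posnP m) => [m0|m0].
  by exists 0 => // [|g _]; rewrite ?mulmx0 ?mul0mx // /row_free mxrank0 m0.
have maschke : ([pchar F]^'.-group G)%g.
  by apply/pgroupP=> p _ _; apply/negP; rewrite F0.
have nz12 : hom_avg rG1 rG2 != 0.
  have := mxrank_hom_avg rG1 rG1.
  rewrite (eq_bigr (fun g => \tr (rG1 g^-1%g) * \tr (rG2 g))).
    rewrite mxrank_hom_avg => /eqP E; apply: contraNneq (hom_avg_neq0 rG1 m0) => z.
    move: E; rewrite z mxrank0 mulr0 eq_sym mulf_eq0.
    by move/pcharf0P: F0 => F0'; rewrite !F0' mxrank_eq0 (gtn_eqF (cardG_gt0 G)).
  by move=> g Gg; rewrite (tr12 g Gg).
have [f nzf homf] := hom_avg_hom nz12.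
have modK : mxmodule rG1 (kermx f).
  apply/mxmoduleP=> g Gg; apply/sub_kermxP.
  by rewrite -mulmxA homf // mulmxA mulmx_ker mul0mx.
have modI : mxmodule rG2 <<f>>%MS.
  rewrite (eqmx_module _ (genmxE _)); apply/mxmoduleP=> g Gg.
  by rewrite -homf // submxMl.
(* The complement [C] of the kernel is isomorphic to the image of [f]. Cancelling that image, the
   kernel and the complement [D] of the image have equal characters; the kernel is proper, so
   induction applies. *)
have [C modC KC1 dxKC] := mx_Maschke_pchar rG1 maschke modK (submx1 _).
have [D modD ID1 dxID] := mx_Maschke_pchar rG2 maschke modI (submx1 _).
have simKD : mx_rsim (submod_repr modK) (submod_repr modD).
  apply: IH.
    apply: leq_trans mN; rewrite mxrank_ker ltn_subrL m0 andbT.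
    by rewrite lt0n mxrank_eq0.
  move=> g Gg; apply: (addrI (\tr (submod_repr modI g))).
  rewrite (mxtrace_dadd_mod modI modD (mxmodule1 rG2) ID1 dxID Gg).
  rewrite (mxtrace_submod1 (mxmodule1 rG2) (eqmx_refl _) Gg) -(tr12 g Gg).
  by rewrite (mxtrace_ker_im modK modI homf Gg) addrC.
have simCI : mx_rsim (submod_repr modC) (submod_repr modI).
  apply: mx_rsim_trans (mx_rsim_factmod_im modK modI homf).
  apply/mx_rsim_sym/mx_rsim_factmod; first by rewrite addsmxC.
  by rewrite mxdirectE /= addsmxC addnC -mxdirectE.
pose rD := Representation (submod_repr modD).
pose rI := Representation (submod_repr modI).
have sim1 : mx_rsim rG1 (dadd_grepr rD rI).
  apply: mx_rsim_trans (mx_rsim_sym (rsim_submod1 (mxmodule1 rG1) _)) _ => //.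
  exact: (@mx_rsim_dadd _ _ _ _ rG1 _ _ _ rD rI modK modC).
apply: mx_rsim_trans sim1 (mx_rsim_sym _).
apply: mx_rsim_trans (mx_rsim_sym (rsim_submod1 (mxmodule1 rG2) _)) _ => //.
apply: (@mx_rsim_dadd _ _ _ _ rG2 _ _ _ rD rI modD modI);
  try exact: mx_rsim_refl.
  by apply: eqmx_trans ID1; rewrite addsmxC.
by rewrite mxdirectE /= addsmxC addnC -mxdirectE.
Qed.
End CharacterZero.
(** * The Specht module of shape (n - 1, 1) *)

Section Hook.
Variables (F : fieldType) (m : nat).
Local Notation n := m.+2.
Local Notation SG := [set: 'S_n].
Local Notation la := [:: m.+1; 1%N].

(** The second row of the tableau holds only [ord_max], placed below [ord0]; the boolean is coerced
    to the row number. *)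
Lemma hook_row (i : 'I_n) : tab_row la i = (i == ord_max).
Proof.
rewrite /tab_row /reshape_index /= subSS subn_eq0 -(inj_eq val_inj) /=.
have := ltn_ord i; rewrite ltnS leq_eqVlt ltnS => /predU1P[->|im].
  by rewrite ltnn eqxx subSnn.
by rewrite im ltn_eqF // ltnS.
Qed.

Lemma hook_col (i : 'I_n) : tab_col la i = if i == ord_max then 0%N else i.
Proof.
rewrite /tab_col /reshape_offset -/(tab_row la i) hook_row.
by case: eqP => [->|_] /=; rewrite ?addn0 ?subnn ?subn0.
Qed.

Lemma hook_row_stab (p : 'S_n) : (p \in row_stab n la) = (p ord_max == ord_max).
Proof.
rewrite inE; apply/forallP/eqP => [/(_ ord_max)|pm i].
  by rewrite !hook_row eqxx eqb1 => /eqP.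
by rewrite !hook_row -{1}pm (inj_eq perm_inj).
Qed.

Lemma hook_col_stab : col_stab n la = [set 1%g; tperm ord0 ord_max].
Proof.
have m0 : (ord0 : 'I_n) != ord_max by [].
apply/setP=> q; rewrite !inE; apply/forallP/orP => [qP|[/eqP->|/eqP->] i].
- have fixq i : q i != ord_max -> i != ord_max -> q i = i.
    move=> qi im; have := qP i; rewrite !hook_col (negbTE qi) (negbTE im).
    by move/eqP/val_inj.
  have [qm|qm] := eqVneq (q ord_max) ord_max; [left|right]; apply/eqP/permP=> i.
    rewrite perm1; have [->//|im] := eqVneq i ord_max.
    by apply: fixq => //; rewrite -qm (inj_eq perm_inj).
  have qm0 : q ord_max = ord0.
    have := qP ord_max; rewrite !hook_col (negbTE qm) eqxx => /eqP E.
    exact: val_inj.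
  have q0 : q ord0 = ord_max.
    apply/eqP; apply: contraT => q0.
    by have := fixq _ q0 m0; rewrite -{2}qm0 => /perm_inj E; rewrite -E eqxx in m0.
  case: tpermP => [->//|->//|i0 im]; apply: fixq; last exact/eqP.
  by rewrite -q0 (inj_eq perm_inj); apply/eqP.
- by rewrite perm1.
rewrite !hook_col; case: tpermP => [->|->|_ _] //.
  by rewrite eqxx.
by rewrite eqxx eq_sym.
Qed.

(* Row x is the sum of the permutations mapping the last letter to x minus the
   sum of those mapping the first letter to x.  This is the map from the
   permutation module (the ideal of the row stabilizer) to the group algebra
   given by the column antisymmetrizer; its kernel is the trivial module. *)
Definition hook_mx : 'M[F]_(#|'I_n|, #|SG|) :=
  \matrix_(x, j) (((enum_val j : 'S_n) ord_max == enum_val x)%:R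
                  - ((enum_val j : 'S_n) ord0 == enum_val x)%:R).

Lemma gring_index_eq (p : 'S_n) j : (gring_index SG p == j) = (p == enum_val j).
Proof.
by apply/eqP/eqP => [<-|->]; rewrite ?gring_valK // gring_indexK ?in_setT.
Qed.

Lemma young_symmetrizer_hook :
  young_symmetrizer F n la = row (enum_rank ord_max) hook_mx.
Proof.
have m0 : (ord0 : 'I_n) != ord_max by [].
have t1 : (1%g : 'S_n) != tperm ord0 ord_max.
  by apply: contra m0 => /eqP/permP/(_ ord0); rewrite perm1 tpermL => ->.
apply/rowP=> j; rewrite [RHS]mxE [RHS]mxE enum_rankK.
pose h : 'S_n := enum_val j; rewrite -/h.
rewrite /young_symmetrizer (eq_bigr (fun p => delta_mx 0 (gring_index SG p)
     - delta_mx 0 (gring_index SG (tperm ord0 ord_max * p)%g))); last first.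
  move=> p _; rewrite hook_col_stab big_setU1 ?inE //= big_set1.
  by rewrite odd_perm1 odd_tperm m0 expr0 expr1 scale1r scaleN1r mul1g.
have single (q : 'S_n) :
    \sum_(p in row_stab n la) (p == q)%:R = (q ord_max == ord_max)%:R :> F.
  rewrite -hook_row_stab; have [qr|qr] := boolP (q \in row_stab n la).
    by rewrite (bigD1 q) //= eqxx big1 ?addr0 // => p /andP[_ /negbTE->].
  by rewrite big1 // => p pr; case: eqP => // pq; rewrite pq (negbTE qr) in pr.
rewrite summxE -[h ord0 == _]/(h ord0 == _).
have -> : h ord0 = (tperm ord0 ord_max * h)%g ord_max by rewrite permM tpermR.
rewrite -!single -sumrB; apply: eq_bigr => p _.
rewrite !mxE !eqxx /= -![_ == gring_index _ _]eq_sym !gring_index_eq -/h.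
by rewrite -(inj_eq (mulgI (tperm ord0 ord_max)) _ (_ * h)%g) mulgA tperm2 mul1g.
Qed.

Let P := act_repr F (perm_action 'I_n).

(** Multiplying on the right by [g] applies [g] last, so permutations sending a letter to [x] become
    those sending it to [g x]. *)
Lemma hook_mxJ g : P g *m hook_mx = hook_mx *m regular_repr F SG g.
Proof.
apply/matrixP=> x j.
pose j' := gring_index SG (enum_val j * g^-1)%g.
have hj' : enum_val j' = (enum_val j * g^-1)%g by rewrite gring_indexK ?in_setT.
rewrite [RHS]mxE (bigD1 j') //= big1 ?addr0 => [|i ij]; last first.
  rewrite [regular_mx _ _ _ _ _]mxE [X in _ * X]mxE eqxx /= eq_sym gring_index_eq.
  case: eqP => [E|]; last by rewrite mulr0.
  case/eqP: ij; apply/eqP; rewrite eq_sym gring_index_eq -E mulgK.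
  by [].
rewrite [regular_mx _ _ _ _ _]mxE [X in _ = _ * X]mxE hj' mulgKV gring_valK !eqxx mulr1.
have -> : (P g *m hook_mx) x j = row x (P g *m hook_mx) 0 j by rewrite [RHS]mxE.
rewrite row_mul rowK -rowE [LHS]mxE !mxE enum_rankK hj' !permM.
by rewrite !(canF_eq (permKV g)) .
Qed.


Lemma hook_mx_row (g : 'S_n) x :
  row (enum_rank (g x)) hook_mx
    = row (enum_rank x) hook_mx *m regular_repr F SG g.
Proof.
by rewrite -row_mul -hook_mxJ row_mul rowK -rowE enum_rankK.
Qed.

(** The group permutes the rows transitively, so the row of [ord_max] generates their span. *)
Lemma hook_mx_cyclic :
  (<<hook_mx>> :=: cyclic_mx (regular_repr F SG) (young_symmetrizer F n la))%MS.
Proof.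
apply/eqmxP; rewrite young_symmetrizer_hook andbC; apply/andP; split.
  apply: cyclic_mx_sub; last by rewrite genmxE row_sub.
  rewrite (eqmx_module _ (genmxE _)); apply/mxmoduleP=> g _.
  by rewrite -hook_mxJ submxMl.
rewrite genmxE; apply/row_subP=> i.
have -> : i = enum_rank (tperm ord_max (enum_val i) ord_max).
  by rewrite tpermL enum_valK.
rewrite hook_mx_row mxmodule_trans ?in_setT ?cyclic_mx_id //.
exact: cyclic_mx_module.
Qed.

Lemma hook_mx_ker : (kermx hook_mx :=: (const_mx 1 : 'rV_#|'I_n|))%MS.
Proof.
have m0 : (ord_max : 'I_n) != ord0 by [].
apply/eqmxP/andP; split; last first.
  apply/sub_kermxP/rowP=> j; rewrite !mxE.
  rewrite (eq_bigr (fun x => ((enum_val j : 'S_n) ord_max == enum_val x)%:R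
     - ((enum_val j : 'S_n) ord0 == enum_val x)%:R)); last first.
    by move=> x _; rewrite !mxE mul1r.
  have one (y : 'I_n) : \sum_(x < #|'I_n|) (y == enum_val x)%:R = 1 :> F.
    rewrite (bigD1 (enum_rank y)) //= enum_rankK eqxx big1 ?addr0 // => x.
    by rewrite -(inj_eq enum_val_inj) enum_rankK eq_sym => /negbTE->.
  by rewrite sumrB !one subrr.
apply/rV_subP=> c /sub_kermxP cB.
suff cc x y : c 0 (enum_rank x) = c 0 (enum_rank y).
  apply/submxP; exists (c 0 (enum_rank ord0))%:M.
  by apply/rowP=> i; rewrite mul_scalar_mx !mxE mulr1 -(enum_valK i); apply: cc.
have [->//|xy] := eqVneq x y.
(* This [h] sends [ord_max] to [x] and [ord0] to [y], so the entry of [c *m hook_mx] at [h] is the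
   difference of the two coordinates. *)
pose t := tperm (ord_max : 'I_n) x; pose h : 'S_n := (t * tperm (t ord0) y)%g.
have tx : t ord0 != x.
  by rewrite -[X in _ != X](tpermL ord_max x) (inj_eq perm_inj) eq_sym.
have hx : h ord_max = x by rewrite permM tpermL tpermD // eq_sym.
have hy : h ord0 = y by rewrite permM tpermL.
have := congr1 (fun M : 'rV_#|SG| => M 0 (gring_index SG h)) cB; rewrite !mxE.
rewrite (eq_bigr (fun z => c 0 z * (enum_rank x == z)%:R
  - c 0 z * (enum_rank y == z)%:R)).
  rewrite sumrB.
  have pick (z : 'I_n) :
      \sum_(k < #|'I_n|) c 0 k * (enum_rank z == k)%:R = c 0 (enum_rank z).
    rewrite (bigD1 (enum_rank z)) //= eqxx mulr1 big1 ?addr0 // => k.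
    by rewrite eq_sym => /negbTE->; rewrite mulr0.
  by rewrite !pick => /eqP; rewrite subr_eq0 => /eqP.
move=> z _; rewrite !mxE gring_indexK ?in_setT // hx hy mulrBr.
rewrite -(inj_eq enum_rank_inj) enum_valK.
by rewrite -[y == _](inj_eq enum_rank_inj) enum_valK.
Qed.

(** The permutation character counts fixed points; the kernel of [hook_mx], a trivial line, accounts
    for the 1. *)
Lemma mxtrace_specht_hook (g : 'S_n) :
  \tr (specht_repr F n la g) = #|[set x | g x == x]|%:R - 1.
Proof.
have modK : mxmodule P (kermx hook_mx).
  apply/mxmoduleP=> h _; apply/sub_kermxP.
  by rewrite -mulmxA hook_mxJ mulmxA mulmx_ker mul0mx.
have modI : mxmodule (regular_repr F SG) <<hook_mx>>%MS.
  by rewrite (eqmx_module _ hook_mx_cyclic) cyclic_mx_module.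
have := mxtrace_ker_im modK modI (fun h _ => hook_mxJ h) (in_setT g).
rewrite mxtrace_act.
have -> : \tr (submod_repr modI g) = \tr (specht_repr F n la g).
  apply: (mxtrace_rsim (G := SG)); rewrite ?in_setT //.
  exact/mx_rsim_iso/eqmx_iso/hook_mx_cyclic.
have -> : submod_repr modK g = 1%:M.
  apply: (@val_submod_inj _ _ (kermx hook_mx)).
  rewrite -[submod_repr modK g]mul1mx val_submodJ ?in_setT //.
  have : (val_submod (1%:M : 'M_(\rank (kermx hook_mx)))
          <= (const_mx 1 : 'rV_#|'I_n|))%MS.
    by rewrite val_submod1 hook_mx_ker.
  case/submxP=> D ->; rewrite -mulmxA; congr (_ *m _).
  apply/rowP=> j; rewrite !mxE (bigD1 (enum_rank (g^-1%g (enum_val j)))) //=.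
  rewrite big1 => [|i ij].
    by rewrite !mxE enum_rankK /= /aperm permKV enum_valK !eqxx mulr1 addr0.
  rewrite !mxE /= mul1r; case: eqP => // jE; case/eqP: ij.
  by rewrite jE enum_rankK /= /aperm permK enum_valK.
have -> : \rank (kermx hook_mx) = 1%N.
  rewrite hook_mx_ker rank_rV; case: eqP => // /rowP/(_ (enum_rank ord0)).
  by rewrite !mxE => /eqP; rewrite oner_eq0.
rewrite mxtrace1 => E.
have -> : #|[set x | g x == x]|%:R = 1 + \tr (specht_repr F n la g) := E.
by rewrite addrC addKr.
Qed.
End Hook.
(** * The homology of rank-selected words *)

Section ReprSums.
Variables (F : fieldType) (gT : finGroupType) (G : {group gT}).
Implicit Types rG : representation F G.

Lemma mxtrace_bigdadd (I : Type) (s : seq I) (P : pred I)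
    (rG : I -> representation F G) g :
  \tr ((\big[dadd_grepr/grepr0]_(i <- s | P i) rG i) g)
    = \sum_(i <- s | P i) \tr (rG i g).
Proof.
apply: (big_morph (fun rW : representation F G => \tr (rW g))) => [rU rV|].
  exact: mxtrace_block.
exact: mxtrace1.
Qed.

Lemma mxtrace_muln rG c g : \tr (muln_grepr rG c g) = c%:R * \tr (rG g).
Proof. by rewrite mxtrace_bigdadd sumr_const card_ord mulr_natl. Qed.

Lemma mxtrace_tensor_power rG i g : \tr (tensor_power rG i g) = \tr (rG g) ^+ i.
Proof.
elim: i => [|i IH]; first exact: mxtrace1.
by rewrite exprS -IH; apply: mxtrace_prod.
Qed.
End ReprSums.

Lemma map_fixed (T : eqType) (f : T -> T) s :
  (map f s == s) = all (fun x => f x == x) s.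
Proof. by elim: s => //= x s <-; rewrite eqseq_cons. Qed.

Section WordHomology.
Variables (F : fieldType) (A : finType) (k r : nat).
Hypotheses (A0 : (0 < #|A|)%N) (r0 : (0 < r)%N) (rk : (r <= k)%N).
Local Notation S := [pred s | (r <= s <= k)%N].
Local Notation P := (word_poset A k S).
Local Notation hom p := (homology_at F (@word_act_mono A k S) p).

(** Lengths increase strictly along a chain and take values between [r] and [k]. *)
Lemma chain_words_bound p (c : chain P p) : (p <= (k - r).+1)%N.
Proof.
have sub : {subset [seq size (val (val u)) | u <- val c] <= iota r (k - r).+1}.
  move=> _ /mapP[u _ ->]; rewrite mem_iota addnS subnKC // ltnS; exact: (valP u).
have uq : uniq [seq size (val (val u)) | u <- val c].
  apply: (sorted_uniq ltn_trans ltnn).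
  apply: (homo_sorted (e := <%O)) (valP c) => u v.
  rewrite lt_neqAle => /andP[neq le].
  rewrite ltn_neqAle size_subseq // andbT.
  by rewrite (size_subseq_leqif (le : subseq _ _)) val_eqE.
by have := uniq_leq_size uq sub; rewrite size_map size_tuple size_iota.
Qed.

Lemma chain_words_empty p : ((k - r).+1 < p)%N -> #|chain P p| = 0%N.
Proof.
move=> kp; apply: eq_card0 => c.
by have := chain_words_bound c; rewrite leqNgt kp.
Qed.

Lemma homology_words_vanish p : p <> (k - r).+1 -> rdegree (hom p) = 0%N.
Proof.
move=> pk; apply: section_sub0; have [kp|kp|//] := ltngtP p (k - r).+1.
  by apply: acyclic_cycles; apply: acyclic_word_poset.
have E := chain_words_empty kp.
move: (cycles P F p) (boundaries P F p); rewrite E => U V.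
by rewrite [U]flatmx0 sub0mx.
Qed.

(** The action keeps the positions of vertices and letters, so a fixed chain is fixed letter by
    letter. *)
Lemma mxtrace_chain_words (s : {perm A}) q :
  \tr (chain_repr F (@word_act_mono A k S) q s)
    = nchains F (fun u : P => all (fun a => s a == a) (val u)) q.
Proof.
rewrite mxtrace_act -sum1_card natr_sum /nchains.
rewrite (reindex_omap (val : chain P q -> _) insub) /=; last first.
  by move=> c /andP[oc _]; rewrite insubT.
apply: eq_bigl => c; rewrite inE valK eqxx andbT (valP c) /=.
rewrite -(inj_eq val_inj) -(inj_eq val_inj) /= map_fixed; apply: eq_all => u.
by rewrite -(inj_eq val_inj) -(inj_eq val_inj) /= map_fixed.
Qed.

Lemma mxtrace_homology_words (s : {perm A}) :
  \tr (hom (k - r).+1 s) = \sum_(1 + (k - r) <= i < k.+1)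
     ('C(k, i) * 'C(i.-1, k - r))%:R * (#|[set a | s a == a]|%:R - 1) ^+ i.
Proof.
(* There are no longer chains, so the top homology is the module of cycles. *)
have b0 : boundaries P F (k - r).+1 = 0.
  apply/eqP; rewrite -submx0 genmxE; move: (boundary_mx P F (k - r).+1).
  by rewrite (chain_words_empty (ltnSn _)) => M; rewrite [M]flatmx0 sub0mx.
rewrite (mxtrace_rsim (mx_rsim_section0 _ _ b0)) ?in_setT //.
rewrite (mxtrace_cycles _ (p := (k - r).+1)) //; last first.
  by move=> j; rewrite ltnS; apply: acyclic_word_poset.
under eq_bigr do rewrite mxtrace_chain_words.
rewrite altchains_words // sum_bin_pred; last by lia.
rewrite subKn // cardsE; congr (_ * (1 - _)).
Qed.
End WordHomology.
Theorem theorem15 (R : realType) (n k r : nat)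
  (hn : (2 <= n)%N) (hr : (1 <= r)%N) (hrk : (r <= k)%N) :
  let H := word_homology R[i] 'I_n k [pred s | (r <= s <= k)%N] in
  (forall m : int, rdegree (H m) <> 0%N <-> m = (k - r)%N%:Z) /\
  mx_rsim (H (k - r)%N%:Z)
    (\big[dadd_grepr/grepr0]_((1 + (k - r))%N <= i < k.+1)
       muln_grepr (tensor_power (specht_repr R[i] n [:: n.-1; 1%N]) i)
                  ('C(k, i) * 'C(i.-1, k - r))%N).
Proof.
case: n hn => [|[|n]] // hn H; set rhs := bigop _ _ _.
have C0 : [pchar R[i]] =i pred0 by apply: pchar_num.
have n0 : (0 < #|'I_n.+2|)%N by rewrite card_ord.
have trH g : \tr (H (k - r)%N%:Z g) = \sum_(1 + (k - r) <= i < k.+1)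
    ('C(k, i) * 'C(i.-1, k - r))%:R * (#|[set a | g a == a]|%:R - 1) ^+ i.
  exact: mxtrace_homology_words.
have simH : mx_rsim (H (k - r)%N%:Z) rhs.
  apply: (mx_rsim_trace C0) => g _; rewrite trH mxtrace_bigdadd.
  apply: eq_bigr => i _.
  by rewrite mxtrace_muln mxtrace_tensor_power mxtrace_specht_hook.
split=> // m; split=> [|->].
  (* Degree [m] means chains on [m + 1] vertices; degree -1 is the case of the empty chain. *)
  case: m => [m|[|m]] /eqP; apply: contraNeq => mk; apply/eqP => //.
    by apply: homology_words_vanish => //; case=> mE; rewrite mE eqxx in mk.
  exact: homology_words_vanish.
(* The trace at the identity is the dimension, a sum of natural numbers whose last term, [i = k], is
   positive because [1 <= r]. *)
move=> H0; have := trH 1%g; rewrite repr_mx1 mxtrace1 H0.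
have -> : #|[set a | (1%g : 'S_n.+2) a == a]| = n.+2.
  rewrite -[RHS]card_ord -cardsT; apply: eq_card => a.
  by rewrite !inE perm1 eqxx.
rewrite -(natrB _ (ltn0Sn _)) subn1 /=.
under eq_bigr do rewrite -natrX -natrM.
rewrite -natr_sum => /eqP; rewrite eq_sym; move/pcharf0P: C0 => ->.
rewrite big_nat_recr /=; last by lia.
rewrite addn_eq0 => /andP[_]; apply/negP; rewrite -lt0n.
by rewrite !muln_gt0 binn bin_gt0 expn_gt0 /= andbT; lia.
Qed.
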